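(* Let $p=p(x_1,x_2,x_3)$ be a polynomial with integer coefficients in three variables which has the spaced polynomial property. Then for any finite entropy irreducible probability measure $\mu$ on the group $G_3(p)$, the Poisson boundary of $(G_3(p),\mu)$ is non-trivial.
   Context: Spaced polynomial property: a Laurent polynomial $p\in\mathbb{Z}[x_1^{\pm1},\dots,x_d^{\pm1}]$ has the spaced polynomial property if there exists an integer $N>0$ such that for every non-zero Laurent polynomial $u$ in $d$ variables with all coefficients in $\{0,1,-1\}$, $p$ does not divide $u(x_1^N,\dots,x_d^N)$ in $\mathbb{Z}[x_1^{\pm1},\dots,x_d^{\pm1}]$. (For $p(x_1,x_2,x_3)$ this is taken with $d=3$.) The group $G_3(p)$: it is the group of upper-triangular $2\times2$ matrices over the ring $\mathbb{Z}[X_1^{\pm1},X_2^{\pm1},X_3^{\pm1}]/(p(X_1,X_2,X_3))$ generated by $$\delta=\begin{pmatrix}1&1\\0&1\end{pmatrix},\qquad M_{x_i}=\begin{pmatrix}1&0\\0&X_i\end{pmatrix}\quad(i=1,2,3).$$ Random walks. For a probability measure $\mu$ on a countable group $G$, the random walk $(G,\mu)$ is the Markov chain on $G$ with transition probability $\mu(h)$ from $g$ to $gh$. It (or $\mu$) is irreducible if $\operatorname{supp}\mu$ generates $G$ as a group. The measure $\mu$ has finite entropy if $H(\mu)=-\sum_{g}\mu(g)\log\mu(g)<\infty$. A function $F$ is $\mu$-harmonic if $F(g)=\sum_{h}F(gh)\mu(h)$ for all $g$. The Poisson boundary of $(G,\mu)$ is non-trivial if and only if there is a non-constant bounded real-valued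 $\mu$-harmonic function on the subgroup of $G$ generated by $\operatorname{supp}\mu$. (For finite entropy $\mu$ this is equivalent to $\lim_n H(\mu^{*n})/n>0$.) *)

(* Defs.v *)
From HB Require Import structures.
From mathcomp Require Import all_boot all_order all_algebra finmap.
From mathcomp Require Import boolp classical_sets functions cardinality fsbigop.
From mathcomp Require Import reals ereal numfun esum exp.
(* The notations of multinomials and of mathcomp-analysis are incompatible. *)
From mathcomp Require Import -(notations) monalg.
From mathcomp Require Import -(notations) mpoly.

Set Implicit Arguments.
Unset Strict Implicit.
Unset Printing Implicit Defensive.

Import Order.TTheory GRing.Theory Num.Theory.
Local Open Scope ring_scope.
Local Open Scope classical_set_scope.

(* The Laurent polynomials in d variables over the integers are the finitely  *)
(* supported families of integers indexed by exponents in Z^d, with the       *)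
(* convolution product: [mcoeff k u] is the coefficient in u of the monomial  *)
(* x^k, and [lmono c k] is the monomial c x^k. The ring structure that monalg *)
(* puts on [malg] does not apply, as it requires exponents without units.     *)
Definition laurent (d : nat) : Type := malg 'rV[int]_d int.

HB.instance Definition _ d := GRing.Zmodule.on (laurent d).

Definition lmono d (c : int) (k : 'rV[int]_d) : laurent d := mkmalgU k c.

HB.lock Definition lmul d (u v : laurent d) : laurent d :=
  \sum_(k1 <- monalg.msupp u) \sum_(k2 <- monalg.msupp v)
    lmono (monalg.mcoeff k1 u * monalg.mcoeff k2 v) (k1 + k2).

Section LaurentRing.
Variable d : nat.
Implicit Types (u v w : laurent d) (k : 'rV[int]_d) (c : int).

Lemma lmono0 k : lmono 0 k = 0. Proof. exact: monalgU0. Qed.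

Lemma lmonoD k : {morph @lmono d ^~ k : c1 c2 / c1 + c2}.
Proof. by move=> c1 c2; exact: monalgUD. Qed.

Lemma laurentE u :
  u = \sum_(k <- monalg.msupp u) lmono (monalg.mcoeff k u) k.
Proof. exact: monalgE. Qed.

Lemma lmulw (d1 d2 : {fset 'rV[int]_d}) u v :
  (monalg.msupp u `<=` d1)%fset -> (monalg.msupp v `<=` d2)%fset ->
  lmul u v = \sum_(k1 <- d1) \sum_(k2 <- d2)
    lmono (monalg.mcoeff k1 u * monalg.mcoeff k2 v) (k1 + k2).
Proof.
move=> le_d1 le_d2; rewrite lmul.unlock (big_fset_incl _ le_d1) /=.
  apply/eq_bigr=> k1 _; apply/big_fset_incl => // k _ /mcoeff_outdom ->.
  by rewrite mulr0 lmono0.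
move=> k _ /mcoeff_outdom ku.
by rewrite big1 // => k' _; rewrite ku mul0r lmono0.
Qed.

Lemma lmulC : commutative (@lmul d).
Proof.
move=> u v; rewrite lmul.unlock exchange_big; apply: eq_bigr => k1 _.
by apply: eq_bigr => k2 _; rewrite mulrC addrC.
Qed.

Lemma lmul0 : left_zero 0 (@lmul d).
Proof. by move=> u; rewrite lmul.unlock monalg.msupp0 big_seq_fset0. Qed.

Lemma lmulDl : left_distributive (@lmul d) +%R.
Proof.
move=> u v w.
rewrite (lmulw (monalg.msuppD_le u v) (fsubset_refl _)).
rewrite (lmulw (fsubsetUl _ (monalg.msupp v)) (fsubset_refl (monalg.msupp w))).
rewrite (lmulw (fsubsetUr (monalg.msupp u) _) (fsubset_refl (monalg.msupp w))).
rewrite -big_split /=; apply/eq_bigr=> k1 _.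
rewrite -big_split /=; apply/eq_bigr=> k2 _.
by rewrite monalg.mcoeffD mulrDl lmonoD.
Qed.

Lemma lmulDr : right_distributive (@lmul d) +%R.
Proof. by move=> u v w; rewrite lmulC lmulDl !(lmulC u). Qed.

Lemma lmulUU c1 c2 k1 k2 :
  lmul (lmono c1 k1) (lmono c2 k2) = lmono (c1 * c2) (k1 + k2).
Proof.
by rewrite (lmulw msuppU_le msuppU_le) !big_seq_fset1 !mcoeffUU.
Qed.

Lemma laurent_ind (P : laurent d -> Prop) :
  P 0 -> (forall u v, P u -> P v -> P (u + v)) ->
  (forall c k, P (lmono c k)) -> forall u, P u.
Proof. by move=> P0 PD P1 u; rewrite (laurentE u); apply: big_ind. Qed.

Lemma lmulA : associative (@lmul d).
Proof.
have lmulr0 : right_zero 0 (@lmul d) by move=> u; rewrite lmulC lmul0.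
move=> u v w; move: u; apply: laurent_ind => [|u1 u2 IH1 IH2|c1 k1].
- by rewrite !lmul0.
- by rewrite !lmulDl IH1 IH2.
move: v; apply: laurent_ind => [|v1 v2 IH1 IH2|c2 k2].
- by rewrite lmulr0 !lmul0 lmulr0.
- by rewrite lmulDl !lmulDr lmulDl IH1 IH2.
move: w; apply: laurent_ind => [|w1 w2 IH1 IH2|c3 k3].
- by rewrite !lmulr0.
- by rewrite !lmulDr IH1 IH2.
by rewrite !lmulUU mulrA addrA.
Qed.

Lemma lmul1 : left_id (lmono 1 0) (@lmul d).
Proof.
apply: laurent_ind => [|u1 u2 IH1 IH2|c k].
- by rewrite lmulC lmul0.
- by rewrite lmulDr IH1 IH2.
by rewrite lmulUU mul1r add0r.
Qed.

Lemma lmono1_neq0 : lmono 1 0 != 0 :> laurent d.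
Proof. by rewrite /lmono monalgU_eq0. Qed.

HB.instance Definition _ := GRing.Zmodule_isComNzRing.Build (laurent d)
  lmulA lmulC lmul1 lmulDl lmono1_neq0.

Definition lX (i : 'I_d) : laurent d := lmono 1 (delta_mx 0 i).
Definition lXV (i : 'I_d) : laurent d := lmono 1 (- delta_mx 0 i).

(* u(x_1^N, ..., x_d^N) *)
Definition lpowvars (N : nat) u : laurent d :=
  \sum_(k <- monalg.msupp u) lmono (monalg.mcoeff k u) (k *+ N).

Definition ldvd u v : Prop := exists w, v = w * u.

Definition spaced_polynomial_property (p : laurent d) : Prop :=
  exists N : nat, (0 < N)%N /\
    forall u, u != 0 ->
      (forall k, monalg.mcoeff k u \in [:: 0; 1; -1]) ->
      ~ ldvd p (lpowvars N u).

End LaurentRing.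

Definition laurent_of_mpoly (d : nat) (p : mpoly d int) : laurent d :=
  mmap (fun c : int => c%:~R) (@lX d) p.

Section LaurentQuotient.
Variables (d : nat) (p : laurent d).

Definition lideal : {pred laurent d} := fun u => `[< ldvd p u >].

Lemma lidealP u : reflect (ldvd p u) (u \in lideal).
Proof. exact: asboolP. Qed.

Lemma lideal_zmod_closed : zmod_closed lideal.
Proof.
split=> [|_ _ /lidealP[u ->] /lidealP[v ->]]; apply/lidealP.
  by exists 0; rewrite mul0r.
by exists (u - v); rewrite mulrBl.
Qed.

HB.instance Definition _ :=
  GRing.isZmodClosed.Build (laurent d) lideal lideal_zmod_closed.

Lemma lidealMl u v : v \in lideal -> u * v \in lideal.
Proof.
by move=> /lidealP[w ->]; apply/lidealP; exists (u * w); rewrite mulrA.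
Qed.

(* The library's [{ideal_quot I}] is a ring only if I is proper, which is not *)
(* assumed here: its underlying additive quotient is given the product that   *)
(* makes it a possibly trivial commutative ring.                              *)
Definition lquot : Type := Quotient.quot lideal.

HB.instance Definition _ := GRing.Zmodule.on lquot.
HB.instance Definition _ := EqQuotient.on lquot.

Definition lproj (u : laurent d) : lquot := \pi_lquot%qT u.

Definition lqmul (x y : lquot) : lquot := lproj (repr x * repr y).

Lemma lprojP u v : reflect (lproj u = lproj v) (u - v \in lideal).
Proof. by rewrite Quotient.idealrBE; apply: eqP. Qed.

Lemma lprojK (x : lquot) : lproj (repr x) = x. Proof. exact: reprK. Qed.

Lemma lprojM u v : lqmul (lproj u) (lproj v) = lproj (u * v).
Proof.
apply/lprojP; set u' := repr _; set v' := repr _.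
have -> : u' * v' - u * v = v' * (u' - u) + u * (v' - v).
  by rewrite !mulrBr addrA (mulrC v' u') (mulrC v' u) subrK.
by apply: rpredD; apply/lidealMl/lprojP; rewrite lprojK.
Qed.

Lemma lprojD u v : lproj u + lproj v = lproj (u + v).
Proof. by rewrite /lproj [RHS]raddfD. Qed.

Lemma lqmulA : associative lqmul.
Proof.
move=> x y z; rewrite -(lprojK x) -(lprojK y) -(lprojK z).
by rewrite !lprojM mulrA.
Qed.

Lemma lqmulC : commutative lqmul.
Proof. by move=> x y; rewrite /lqmul mulrC. Qed.

Lemma lqmul1 : left_id (lproj 1) lqmul.
Proof. by move=> x; rewrite -(lprojK x) lprojM mul1r. Qed.

Lemma lqmulDl : left_distributive lqmul +%R.
Proof.
move=> x y z; rewrite -(lprojK x) -(lprojK y) -(lprojK z).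
by rewrite !(lprojD, lprojM) mulrDl.
Qed.

HB.instance Definition _ := GRing.Zmodule_isComPzRing.Build lquot
  lqmulA lqmulC lqmul1 lqmulDl.

End LaurentQuotient.

(* The group of units of a ring, each unit being paired with its inverse.     *)
Section RingUnits.
Variable S : pzRingType.

Definition ring_units : Type :=
  {x : S * S | (x.1 * x.2 == 1) && (x.2 * x.1 == 1)}.

HB.instance Definition _ := Choice.on ring_units.

Implicit Types x y z : ring_units.

Definition mkunit (a b : S) (ab : a * b = 1) (ba : b * a = 1) : ring_units :=
  exist _ (a, b) (introT andP (conj (introT eqP ab) (introT eqP ba))).

Definition unit_val x : S := (val x).1.
Definition unit_inv x : S := (val x).2.

Lemma unit_valV x : unit_val x * unit_inv x = 1.
Proof. by have /andP[/eqP ? _] := valP x. Qed.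

Lemma unit_invV x : unit_inv x * unit_val x = 1.
Proof. by have /andP[_ /eqP ?] := valP x. Qed.

Lemma unit_val_inj : injective unit_val.
Proof.
move=> x y xy; apply/val_inj.
have xyV : unit_inv x = unit_inv y.
  by rewrite -[LHS]mulr1 -(unit_valV y) -xy mulrA unit_invV mul1r.
by rewrite [LHS]surjective_pairing [RHS]surjective_pairing; congr pair.
Qed.

Definition units_one : ring_units := mkunit (mulr1 1) (mulr1 1).

Definition units_inv x : ring_units := mkunit (unit_invV x) (unit_valV x).

Lemma units_mul_subproof x y :
  (unit_val x * unit_val y) * (unit_inv y * unit_inv x) = 1.
Proof. by rewrite mulrA -(mulrA (unit_val x)) unit_valV mulr1 unit_valV. Qed.

Lemma units_mul_subproofV x y :
  (unit_inv y * unit_inv x) * (unit_val x * unit_val y) = 1.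
Proof. by rewrite mulrA -(mulrA (unit_inv y)) unit_invV mulr1 unit_invV. Qed.

Definition units_mul x y : ring_units :=
  mkunit (units_mul_subproof x y) (units_mul_subproofV x y).

Lemma units_mulA : associative units_mul.
Proof. by move=> x y z; apply: unit_val_inj; exact: mulrA. Qed.

Lemma units_mul1 : left_id units_one units_mul.
Proof. by move=> x; apply: unit_val_inj; exact: mul1r. Qed.

Lemma units_mulr1 : right_id units_one units_mul.
Proof. by move=> x; apply: unit_val_inj; exact: mulr1. Qed.

Lemma units_mulV : left_inverse units_one units_inv units_mul.
Proof. by move=> x; apply: unit_val_inj; exact: unit_invV. Qed.

Lemma units_mulrV : right_inverse units_one units_inv units_mul.
Proof. by move=> x; apply: unit_val_inj; exact: unit_valV. Qed.

HB.instance Definition _ := isGroup.Build ring_units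
  units_mulA units_mul1 units_mulr1 units_mulV units_mulrV.

End RingUnits.

Section GeneratedSubgroup.
Variable G : groupType.

Definition is_subgroup (H : set G) : Prop :=
  H 1%g /\ forall x y, H x -> H y -> H (x / y)%g.

Definition generated (A : set G) : set G := smallest is_subgroup A.

Variable A : set G.

Lemma generated_group_closed : group_closed (mem (generated A)).
Proof.
split=> [|x y /set_mem xA /set_mem yA]; apply/mem_set => H HA.
  by case: HA => -[].
by case: (HA) => -[_ HV] _; exact: HV (xA H HA) (yA H HA).
Qed.

Definition gen_group : Type := {x : G | x \in generated A}.

HB.instance Definition _ := SubChoice.on gen_group.
HB.instance Definition _ :=
  SubChoice_isSubGroup.Build G (mem (generated A)) gen_group
    generated_group_closed.

End GeneratedSubgroup.

Section UpperTriangular.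
Variable A : comPzRingType.

(* The matrix with rows (a, b) and (0, c). *)
Definition ut (a b c : A) : 'M[A]_2 :=
  \matrix_(i, j) if i == 0 then (if j == 0 then a else b)
                 else (if j == 0 then 0 else c).

Lemma utM a b c a' b' c' :
  ut a b c * ut a' b' c' = ut (a * a') (a * b' + b * c') (c * c').
Proof.
apply/matrixP => i j; rewrite mxE !big_ord_recl big_ord0 !mxE /= addr0.
by case: (i == 0); case: (j == 0); rewrite ?(mul0r, mulr0, addr0, add0r).
Qed.

Lemma ut1 : ut 1 0 1 = 1.
Proof.
apply/matrixP => i j; rewrite !mxE.
by case: i j => [[|[|//]] ?] [[|[|//]] ?].
Qed.

Lemma delta_unit_subproof (e : A) : ut 1 e 1 * ut 1 (- e) 1 = 1.
Proof. by rewrite utM !mul1r mulr1 addNr ut1. Qed.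

Lemma diag_unit_subproof (c c' : A) : c * c' = 1 -> ut 1 0 c * ut 1 0 c' = 1.
Proof. by move=> cc'; rewrite utM cc' mulr0 mul0r addr0 mulr1 ut1. Qed.

End UpperTriangular.

Section GroupOfPolynomial.
Variables (d : nat) (p : laurent d).

Local Notation A := (lquot p).
Local Notation GL := (ring_units 'M[A]_2).

Lemma lXK (i : 'I_d) : lproj p (lX i) * lproj p (lXV i) = 1.
Proof.
have XV : lX i * lXV i = 1 by rewrite [LHS]lmulUU subrr mulr1.
by rewrite [LHS]lprojM XV.
Qed.

Lemma lXVK (i : 'I_d) : lproj p (lXV i) * lproj p (lX i) = 1.
Proof. by rewrite mulrC lXK. Qed.

Lemma delta_unit_subproofV : ut (1 : A) (- 1) 1 * ut 1 1 1 = 1.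
Proof. by rewrite -[in RHS](delta_unit_subproof (- 1)) opprK. Qed.

Definition delta_gen : GL :=
  mkunit (delta_unit_subproof (1 : A)) delta_unit_subproofV.

Definition M_gen (i : 'I_d) : GL :=
  mkunit (diag_unit_subproof (lXK i)) (diag_unit_subproof (lXVK i)).

(* The group G_d(p). *)
Definition Gpoly : Type := gen_group ([set delta_gen] `|` range M_gen).

HB.instance Definition _ := Group.on Gpoly.

End GroupOfPolynomial.

Section RandomWalk.
Variables (R : realType) (G : groupType).
Implicit Types (mu : G -> R) (F : G -> R).

(* G is countable in the intended use, so that a probability measure on G is  *)
(* given by its values on points.                                             *)
Definition is_probability mu : Prop :=
  (forall g, 0 <= mu g) /\ \esum_(g in [set: G]) (mu g)%:E = 1%E.

Definition supp mu : set G := [set g | mu g != 0].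

Definition irreducible mu : Prop := generated (supp mu) = [set: G].

(* In the library, ln 0 = 0. *)
Definition entropy mu : \bar R :=
  \esum_(g in [set: G]) (- (mu g * ln (mu g)))%:E.

Definition finite_entropy mu : Prop := (entropy mu < +oo)%E.

(* [esum] is only meaningful for nonnegative families. If the positive or the *)
(* negative part below has an infinite sum, then so is the result.            *)
Definition sum_over_group (f : G -> R) : \bar R :=
  (\esum_(h in [set: G]) (Num.max (f h) 0)%:E -
   \esum_(h in [set: G]) (Num.max (- f h) 0)%:E)%E.

Definition harmonic_at mu F (g : G) : Prop :=
  (F g)%:E = sum_over_group (fun h => F (g * h)%g * mu h).

(* The functions on the subgroup H generated by the support of mu are         *)
(* represented by functions on G, whose values outside H play no role: if g   *)
(* is in H and mu h is nonzero, then g h is in H.                             *)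
Definition poisson_boundary_nontrivial mu : Prop :=
  let H := generated (supp mu) in
  exists F : G -> R,
    [/\ exists C : R, forall g, H g -> `|F g| <= C,
        forall g, H g -> harmonic_at mu F g
      & exists x y, [/\ H x, H y & F x <> F y]].

End RandomWalk.

(* Main.v *)
(* Let [nu] be the average of [mu] and the unit mass, and let [H_n] be the      *)
(* entropy of the [nu]-walk at time [n]. If all bounded harmonic functions are  *)
(* constant, then [g nu^n - nu^n] tends to 0 in total variation for every [g],  *)
(* and finite entropy turns this into [H_(n+1) - H_n -> 0]. On the other hand   *)
(* [H_n] grows linearly. Choose [a], [b] in the support of [mu] whose products  *)
(* [a b] and [b a] differ by an element [q] of the ring that no nonzero         *)
(* [u(x_1^N, x_2^N, x_3^N)] with coefficients in {0, 1, -1} kills; then,        *)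
(* conditionally on the rest of the walk, the independent choices between       *)
(* [a b] and [b a] made at distinct points of one coset of [N Z^3] are          *)
(* determined by the endpoint, and as the projection to Z^3 is transient there  *)
(* are linearly many such points.                                               *)
(* All entropies and total variations are computed for finitely supported       *)
(* truncations of [nu]: the truncation is fixed before [n] tends to infinity,   *)
(* the estimates being uniform in it.                                           *)
Require Import Defs.
From HB Require Import structures.
From mathcomp Require Import all_boot all_order all_algebra finmap.
From mathcomp Require Import boolp classical_sets functions cardinality fsbigop.
From mathcomp Require Import reals ereal esum exp filter.
From mathcomp Require Import ring lra zify.
From mathcomp Require Import -(notations) monalg.
From mathcomp Require Import -(notations) mpoly.

Set Implicit Arguments.
Unset Strict Implicit.
Unset Printing Implicit Defensive.

Import Order.TTheory GRing.Theory Num.Theory.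

(** * Binomial weights *)

(** Boundary and entropy are tied together as follows. One more step of a lazy walk changes its law
    at time n by O(n^(-1/2)) ([iter_trunc_dist_le]), so the functions P^n f are almost harmonic. If
    they separate some g from 1 at all times, a limit point is a nonconstant bounded harmonic
    function of [mu] ([exists_harmonic]). Otherwise the laws started from g and from 1 merge. The
    increment of the entropy is a mean of logarithms of ratios between such laws, so it becomes
    small: [Ent_step_fine] treats finitely many letters, and the finite entropy of [mu] treats the
    rest ([Ent_increment]).

    The linear growth is where the polynomial enters. A group element amounts to an exponent [K g]
    in Z^3 and a ring element [up g], with up(gh) = up(g) x^K(h) + up(h). Exchanging ab and ba when
    the displacement still to come is k changes [up] of the endpoint by q x^k, where q = up(ab) -
    up(ba). The ring elements killed, for every N, by some nonzero u(x^N) with coefficients in {0,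
    1, -1} form an ideal ([spaced_torsionD]), which contains no x^k - 1 with k nonzero
    ([spaced_not_torsion]); hence some a, b in the support have q outside it
    ([exists_comm_not_torsion]). For a suitable N, exchanges at distinct positions of one class
    modulo N can then be read off the endpoint ([separation_of_not_torsion]), and each contributes
    one bit of entropy ([Entn_switch_ge]). The support contains three independent displacements
    ([exists_independent_steps]), so the Green function is bounded ([green_le]) and the number of
    distinct positions is linear in n. The resulting rate is the same for all large truncations
    ([Ent_growth]), which contradicts small increments ([liouville_absurd]). *)

Section Binomial.
Local Open Scope nat_scope.

Lemma leq_bin_succ n k : (k.*2 < n) -> 'C(n, k) <= 'C(n, k.+1).
Proof.
move=> kn; rewrite -(@leq_pmul2l k.+1) // mulSnr.
have := mul_bin_left n k; move: 'C(n, k) 'C(n, k.+1) => x y; nia.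
Qed.

Lemma geq_bin_succ n k : (n <= k.*2.+1) -> 'C(n, k.+1) <= 'C(n, k).
Proof.
move=> kn; have := mul_bin_left n k; move: 'C(n, k) 'C(n, k.+1) => x y; nia.
Qed.

Lemma leq_bin_half n k : 'C(n, k) <= 'C(n, n./2).
Proof.
have [kn|nk] := leqP k n./2.
  have up i : i + k <= n./2 -> 'C(n, k) <= 'C(n, i + k).
    elim: i => // i IH ikn; apply: leq_trans (IH _) _; first by lia.
    by apply: leq_bin_succ; lia.
  by have := up (n./2 - k); rewrite subnK // => ->.
have down i : 'C(n, i + n./2) <= 'C(n, n./2).
  elim: i => // i IH; apply: leq_trans IH; rewrite addSn.
  by apply: geq_bin_succ; lia.
by have := down (k - n./2); rewrite subnK // ltnW.
Qed.

(** The central binomial estimate C(2m, m) = O(4^m / sqrt m), in a form that passes by induction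
    since C(2m+2, m+1) is 2(2m+1)/(m+1) times C(2m, m). *)
Lemma bin_half_sqr_double m : m.*2.+1 * 'C(m.*2, m) ^ 2 <= 4 ^ m.*2.
Proof.
elim: m => // m IH.
have e1 := mul_bin_diag m.*2.+2 m; have e2 := mul_bin_down m.*2.+1 m.
rewrite doubleS /= in e1 e2 *; rewrite !expnS expn0 !muln1.
have e : m.+1 * 'C(m.*2.+2, m.+1) = (m.*2.+1).*2 * 'C(m.*2, m).
  rewrite -e1 -doubleS -doubleMl mulnC; rewrite -doubleMl e2.
  by rewrite (_ : m.*2.+1 - m = m.+1) -?doubleMl -?doubleMr 1?mulnC //; lia.
rewrite -(@leq_pmul2l (m.+1 ^ 2)) //; move: e IH.
move: 'C(m.*2.+2, m.+1) 'C(m.*2, m) (4 ^ m.*2) => x y z e IH.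
have -> : m.+1 ^ 2 * (m.*2.+3 * (x * x)) = m.*2.+3 * (m.+1 * x) ^ 2 by ring.
rewrite e; nia.
Qed.

Lemma bin_sqr_le n k : n.+1 * 'C(n, k) ^ 2 <= 4 ^ n.
Proof.
apply: (@leq_trans (n.+1 * 'C(n, n./2) ^ 2)).
  by rewrite leq_mul2l leq_sqr leq_bin_half orbT.
rewrite -[n in X in X <= _]odd_double_half -[n in X in _ <= X]odd_double_half.
case: (odd n) => /=; last by rewrite !add0n doubleK bin_half_sqr_double.
rewrite add1n /= uphalf_double; set m := n./2.
have e1 := mul_bin_diag m.*2.+2 m; have := bin_half_sqr_double m.+1.
rewrite doubleS /= in e1 *; rewrite -!mulnn !expnS; move: e1.
move: 'C(m.*2.+2, m.+1) 'C(m.*2.+1, m) (4 ^ m.*2) => x y z e.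
have {e} -> : x = y.*2 by nia.
nia.
Qed.

End Binomial.

Section BinomialWeights.
Variable R : realType.
Local Open Scope ring_scope.
Implicit Types (n j k : nat).

Definition binw n k : R := 'C(n, k)%:R / 2 ^+ n.

Lemma binw_ge0 n k : 0 <= binw n k.
Proof. by rewrite /binw divr_ge0 ?ler0n ?exprn_ge0. Qed.

Definition invsqrt n : R := (Num.sqrt n.+1%:R)^-1.

Lemma invsqrt_gt0 n : 0 < invsqrt n.
Proof. by rewrite /invsqrt invr_gt0 sqrtr_gt0 ltr0n. Qed.

Lemma invsqrt_sqr n : invsqrt n ^+ 2 = n.+1%:R^-1.
Proof. by rewrite /invsqrt exprVn sqr_sqrtr ?ler0n. Qed.

Lemma binw_le n k : binw n k <= invsqrt n.
Proof.
rewrite -(@ler_pXn2r _ 2) ?nnegrE ?binw_ge0 ?(ltW (invsqrt_gt0 _)) //.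
rewrite invsqrt_sqr /binw expr_div_n -exprM mulnC exprM -natrX.
rewrite ler_pdivrMr ?exprn_gt0 ?exprn_even_gt0 // ler_pdivlMl ?ltr0n //.
by rewrite -natrM -!natrX ler_nat bin_sqr_le.
Qed.

Lemma invsqrt_decr n : invsqrt n.+1 <= invsqrt n.
Proof.
by rewrite /invsqrt lef_pV2 ?posrE ?sqrtr_gt0 ?ltr0n // ler_sqrt ?ler0n // ler_nat.
Qed.

(** The right-hand side telescopes, so the cubes are summable. This is where rank three matters: the
    exponent 3/2 exceeds 1. *)
Lemma invsqrt_cube_le n :
  invsqrt n.+1 ^+ 3 <= 2 * (invsqrt n - invsqrt n.+1).
Proof.
have a0 := invsqrt_gt0 n.+1; have b0 := invsqrt_gt0 n.
have ab := invsqrt_decr n.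
have e : invsqrt n ^+ 2 - invsqrt n.+1 ^+ 2 = invsqrt n ^+ 2 * invsqrt n.+1 ^+ 2.
  rewrite !invsqrt_sqr -[n.+2]addn1 natrD.
  have n0 : n.+1%:R != 0 :> R by rewrite pnatr_eq0.
  have n1 : n.+1%:R + 1 != 0 :> R by rewrite -(natrD _ _ 1) pnatr_eq0 addn1.
  by move: (n.+1%:R) n0 n1 => x n0 n1; field; rewrite n0 n1.
move: (invsqrt n.+1) (invsqrt n) a0 b0 ab e => a b a0 b0 ab e.
have h : b * (b * a ^+ 2) <= b * (2 * (b - a)).
  have -> : b * (b * a ^+ 2) = (b - a) * (b + a) by rewrite -subr_sqr e; ring.
  by rewrite mulrCA mulrC; nra.
rewrite ler_pM2l // in h; apply: le_trans h.
by rewrite exprSr mulrC ler_wpM2r ?exprn_ge0 // ltW.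
Qed.

Section Unimodal.
Variables (a : nat -> R) (b : nat -> R).
Hypothesis a01 : forall k, 0 <= a k <= 1.

Lemma sum_incr_diff_le m :
  (forall k, 0 <= b k) -> (forall k, (k < m)%N -> b k <= b k.+1) ->
  \sum_(k < m.+1) b k * (a k.+1 - a k) <= b m * a m.+1.
Proof.
move=> b0; elim: m => [|m IH] bm.
  rewrite big_ord1; have := a01 0; have := b0 0%N; nra.
rewrite big_ord_recr /=; have {IH} := IH (fun k km => bm k (ltnW km)).
have := bm m (ltnSn _); have := a01 m.+1; nra.
Qed.

Lemma sum_decr_diff_le m n :
  (forall k, 0 <= b k) -> (forall k, (m <= k)%N -> b k.+1 <= b k) ->
  \sum_(k < n) b (m + k)%N * (a (m + k).+1 - a (m + k)%N) <= b m * (1 - a m).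
Proof.
move=> b0; elim: n m => [|n IH] m bm.
  by rewrite big_ord0; have := a01 m; have := b0 m; nra.
rewrite big_ord_recl /= addn0.
have /le_trans := lerD (lexx (b m * (a m.+1 - a m))) (IH m.+1 (fun k km => bm k (ltnW km))).
under eq_bigr do rewrite /bump /= addnA addn1.
apply; have := bm m (leqnn _); have := a01 m.+1; have := b0 m.+1; nra.
Qed.

End Unimodal.

(** The weights rise up to n/2 and fall afterwards; Abel summation on each side leaves boundary
    terms bounded by the largest weight. In other words, a binomial law and its shift by one are at
    distance O(n^(-1/2)). *)
Lemma binw_diff_le n (a : nat -> R) : (forall k, 0 <= a k <= 1) ->
  \sum_(k < n.+1) binw n k * (a k.+1 - a k) <= invsqrt n.
Proof.
move=> a01; apply: le_trans (binw_le n n./2).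
have nE : (n.+1 = n./2.+1 + (n - n./2))%N by rewrite addSn subnKC //; lia.
rewrite nE big_split_ord /=.
have up := @sum_incr_diff_le a (binw n) a01 n./2 (binw_ge0 n) _.
have dn := @sum_decr_diff_le a (binw n) a01 n./2.+1 (n - n./2) (binw_ge0 n) _.
apply: (le_trans (lerD (up _) (dn _))) => [k kn|k kn|].
- rewrite ler_pM2r ?invr_gt0 ?exprn_gt0 // ler_nat leq_bin_succ //; lia.
- rewrite ler_pM2r ?invr_gt0 ?exprn_gt0 // ler_nat geq_bin_succ //; lia.
have : binw n n./2.+1 <= binw n n./2.
  by rewrite ler_pM2r ?invr_gt0 ?exprn_gt0 // ler_nat leq_bin_half.
have := a01 n./2.+1; nra.
Qed.

End BinomialWeights.

(** * Random walks with finitely many steps and their entropy *)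

Section Expectation.
Variable R : realType.
Local Open Scope ring_scope.

Fixpoint Ex (U : finType) (u : U -> R) (n : nat) (f : seq U -> R) : R :=
  if n is n'.+1 then \sum_t u t * Ex u n' (fun l => f (t :: l)) else f [::].

Section Basics.
Variables (U : finType) (u : U -> R).
Implicit Types (f g : seq U -> R) (n : nat).

Lemma eq_Ex n f g : (forall l, size l = n -> f l = g l) -> Ex u n f = Ex u n g.
Proof.
elim: n f g => [|n IH] f g fg /=; first exact: fg.
by apply: eq_bigr => t _; congr (_ * _); apply: IH => l ln; rewrite fg //= ln.
Qed.

Lemma ExD n f g : Ex u n (fun l => f l + g l) = Ex u n f + Ex u n g.
Proof.
elim: n f g => [|n IH] f g //=.
by rewrite -big_split; apply: eq_bigr => t _; rewrite /= IH mulrDr.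
Qed.

Lemma ExZ n c f : Ex u n (fun l => c * f l) = c * Ex u n f.
Proof.
elim: n f => [|n IH] f //=.
by rewrite mulr_sumr; apply: eq_bigr => t _; rewrite /= IH mulrCA.
Qed.

Lemma ExZr n c f : Ex u n (fun l => f l * c) = Ex u n f * c.
Proof. by rewrite mulrC -ExZ; apply: eq_Ex => l _; rewrite mulrC. Qed.

Lemma ExN n f : Ex u n (fun l => - f l) = - Ex u n f.
Proof. by rewrite -mulN1r -ExZ; apply: eq_Ex => l _; rewrite mulN1r. Qed.

Lemma ExB n f g : Ex u n (fun l => f l - g l) = Ex u n f - Ex u n g.
Proof. by rewrite ExD ExN. Qed.

Lemma Ex_sum n (I : Type) (r : seq I) (P : pred I) (f : I -> seq U -> R) :
  Ex u n (fun l => \sum_(i <- r | P i) f i l) =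
  \sum_(i <- r | P i) Ex u n (f i).
Proof.
elim: r => [|i r IH].
  rewrite big_nil -[RHS](mul0r (Ex u n (fun=> 0))) -ExZ.
  by apply: eq_Ex => l _; rewrite big_nil mul0r.
rewrite big_cons; case: ifP => Pi; rewrite -IH -?ExD; apply: eq_Ex => l _;
  by rewrite big_cons Pi.
Qed.

Hypothesis u0 : forall t, 0 <= u t.

Lemma le_Ex n f g : (forall l, size l = n -> f l <= g l) -> Ex u n f <= Ex u n g.
Proof.
elim: n f g => [|n IH] f g fg /=; first exact: fg.
by apply: ler_sum => t _; apply: ler_wpM2l => //; apply: IH => l ln; rewrite fg //= ln.
Qed.

Lemma Ex_const n c : \sum_t u t = 1 -> Ex u n (fun=> c) = c.
Proof. by move=> u1; elim: n => //= n ->; rewrite -mulr_suml u1 mul1r. Qed.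

Lemma Ex_ge0 n f : (forall l, 0 <= f l) -> 0 <= Ex u n f.
Proof.
move=> f0; have -> : 0 = Ex u n (fun=> 0) :> R; last exact: le_Ex.
by elim: n {f f0} => //= n <-; rewrite big1 // => t _; rewrite mulr0.
Qed.

End Basics.

Lemma Ex_exchange (U V : finType) (u : U -> R) (v : V -> R) m n
    (f : seq U -> seq V -> R) :
  Ex u m (fun l => Ex v n (f l)) = Ex v n (fun l' => Ex u m (f ^~ l')).
Proof.
elim: m f => [|m IH] f //=; rewrite Ex_sum; apply: eq_bigr => t _.
by rewrite ExZ IH.
Qed.

Lemma Ex_pair (U V : finType) (u : U -> R) (v : V -> R) n
    (f : seq (U * V) -> R) :
  Ex (fun st => u st.1 * v st.2) n f = Ex u n (fun l => Ex v n (fun l' => f (zip l l'))).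
Proof.
elim: n f => [|n IH] f //=.
transitivity (\sum_s \sum_t u s * v t *
    Ex (fun st : U * V => u st.1 * v st.2) n (fun l => f ((s, t) :: l))).
  by rewrite pair_bigA; apply: eq_bigr => -[s t] _.
apply: eq_bigr => s _.
rewrite -ExZ -[RHS]/(Ex u n (fun l => _)).
under [RHS]eq_Ex do rewrite mulr_sumr.
rewrite Ex_sum; apply: eq_bigr => t _.
under [RHS]eq_Ex do rewrite mulrA.
by rewrite ExZ IH.
Qed.

End Expectation.

Section MarkovOperator.
Variables (R : realType) (G : groupType) (U : finType) (u : U -> R) (x : U -> G).
Local Open Scope ring_scope.
Implicit Types (f : G -> R) (g : G) (n : nat).

Definition step f g : R := \sum_t u t * f (g * x t)%g.

Definition word (l : seq U) : G := foldr (fun t g => x t * g)%g 1%g l.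

Lemma iter_stepE n f g : iter n step f g = Ex u n (fun l => f (g * word l)%g).
Proof.
elim: n g => [|n IH] g; first by rewrite /= mulg1.
rewrite iterS /step /=; apply: eq_bigr => t _; rewrite IH; congr (_ * _).
by apply: eq_Ex => l _; rewrite mulgA.
Qed.

Lemma iter_step_trans n f g h : iter n step (fun y => f (h * y)%g) g = iter n step f (h * g)%g.
Proof. by rewrite !iter_stepE; apply: eq_Ex => l _; rewrite mulgA. Qed.

Hypotheses (u0 : forall t, 0 <= u t) (u1 : \sum_t u t = 1).

Lemma iter_step01 n f g : (forall y, 0 <= f y <= 1) -> 0 <= iter n step f g <= 1.
Proof.
move=> f01; rewrite iter_stepE Ex_ge0 //=; last by move=> l; case/andP: (f01 (g * word l)%g).
rewrite -[leRHS](Ex_const n _ u1); apply: le_Ex => // l _.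
by case/andP: (f01 (g * word l)%g).
Qed.

End MarkovOperator.

(** * Entropy of the walk and its increments *)

Section Entropy.
Variables (R : realType) (G : groupType).
Local Open Scope ring_scope.

(** The law is given by its expectation functional, so that the entropy depends on the Markov
    operator only and the alphabet presenting the walk can be changed freely. *)
Definition Ent (E : (G -> R) -> R) : R :=
  E (fun y => - ln (E (fun z => (z == y)%:R))).

Variables (U : finType) (u : U -> R) (x : U -> G).
Hypotheses (u0 : forall t, 0 < u t) (u1 : \sum_t u t = 1).

Let P := step u x.

Definition mass n y : R := iter n P (fun z => (z == y)%:R) 1%g.

Definition Entn n : R := Ent (fun f => iter n P f 1%g).

Lemma massE n y : mass n y = Ex u n (fun l => (word x l == y)%:R).
Proof. by rewrite /mass iter_stepE; apply: eq_Ex => l _; rewrite mul1g. Qed.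

Lemma EntnE n : Entn n = Ex u n (fun l => - ln (mass n (word x l))).
Proof. by rewrite /Entn /Ent iter_stepE; apply: eq_Ex => l _; rewrite mul1g. Qed.

Lemma mass_ge0 n y : 0 <= mass n y.
Proof. by rewrite massE; apply: Ex_ge0 => [t|l]; [exact: ltW|exact: ler0n]. Qed.

Lemma massS n y : mass n.+1 y = \sum_t u t * mass n ((x t)^-1 * y)%g.
Proof.
rewrite massE /=; apply: eq_bigr => t _; rewrite massE; congr (_ * _).
by apply: eq_Ex => l _; rewrite /= (can2_eq (mulKg _) (mulVKg _)).
Qed.

Lemma massS_ge n t y : u t * mass n y <= mass n.+1 (x t * y)%g.
Proof.
rewrite massS (bigD1 t) //= mulKg lerDl sumr_ge0 // => s _.
by rewrite mulr_ge0 ?mass_ge0 // ltW.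
Qed.

Lemma mass_word_gt0 n l : size l = n -> 0 < mass n (word x l).
Proof.
elim: l n => [|t l IH] [|n] //=; first by rewrite massE /= eqxx ltr01.
by move=> [/IH ln]; apply: lt_le_trans (massS_ge _ _ _); rewrite mulr_gt0.
Qed.

(** The first letter of the longer word is split off, and the remaining n letters serve as the word
    of the shorter walk. *)
Lemma EntnS n : Entn n.+1 - Entn n = \sum_t u t *
  Ex u n (fun l => ln (mass n (word x l) / mass n.+1 (x t * word x l)%g)).
Proof.
have -> : Entn n = \sum_t u t * Entn n by rewrite -mulr_suml u1 mul1r.
rewrite EntnE /= -sumrB; apply: eq_bigr => t _; rewrite -mulrBr EntnE -ExB.
congr (_ * _); apply: eq_Ex => l szl; rewrite opprK addrC ln_div //.
  by rewrite posrE mass_word_gt0.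
by rewrite posrE; apply: (@mass_word_gt0 n.+1 (t :: l)); rewrite /= szl.
Qed.

Lemma Ent_step_crude n t :
  Ex u n (fun l => ln (mass n (word x l) / mass n.+1 (x t * word x l)%g)) <= - ln (u t).
Proof.
rewrite -[leRHS](Ex_const n _ u1); apply: le_Ex => [s|l szl]; first exact: ltW.
have m0 := mass_word_gt0 szl; have := massS_ge n t (word x l).
move: (mass _ _) (mass _ _) m0 => b a a0 ab.
have b0 : 0 < b by apply: lt_le_trans ab; rewrite mulr_gt0.
rewrite -lnV ?posrE // ler_ln ?posrE ?divr_gt0 ?invr_gt0 //.
by rewrite ler_pdivrMr // mulrC ler_pdivlMr // mulrC.
Qed.

(* [ln r <= r - 1], and the probability ratio [r] is at most [1 / u t]. *)
Lemma Ent_step_fine n t (e : R) :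
  (forall f, (forall y, 0 <= f y <= 1) -> iter n P f (x t) - iter n.+1 P f 1%g <= e) ->
  u t * Ex u n (fun l => ln (mass n (word x l) / mass n.+1 (x t * word x l)%g)) <= e.
Proof.
move=> close.
(* [D] is the event that the logarithm is positive. Tested on the translate of [D] by [x t], the
   hypothesis bounds the mean over [D] of one minus the ratio of [mass n.+1 (x t * y)] to
   [mass n y]. *)
pose D y := (mass n.+1 (x t * y)%g < mass n y)%R.
pose f y := (D ((x t)^-1 * y)%g)%:R : R.
apply: le_trans (close f _); last by move=> y; rewrite /f; case: (D _); rewrite !lexx ler01.
rewrite -[X in iter n P f X]mulg1 -iter_step_trans !iter_stepE.
rewrite -ExZ.
have -> : Ex u n (fun l => f (x t * (1 * word x l))%g) = Ex u n (fun l => (D (word x l))%:R).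
  by apply: eq_Ex => l _; rewrite /f mul1g mulKg.
have -> : Ex u n.+1 (fun l => f (1 * word x l)%g) =
  Ex u n (fun l => (D (word x l))%:R * (mass n.+1 (x t * word x l)%g / mass n (word x l))).
  transitivity (Ex u n (fun l => Ex u n.+1 (fun l' =>
    (D (word x l))%:R / mass n (word x l) * (word x l' == x t * word x l)%g%:R)));
    last first.
    by apply: eq_Ex => l _; rewrite ExZ -massE mulrAC mulrA.
  rewrite Ex_exchange; apply: eq_Ex => l' _; rewrite mul1g.
  transitivity (Ex u n (fun l => f (word x l') / mass n ((x t)^-1 * word x l')%g *
    (word x l == (x t)^-1 * word x l')%g%:R)).
    rewrite ExZ -massE /f /D; case: ltP => [lt|]; last by rewrite !mul0r.
    by rewrite divfK // gt_eqF // (le_lt_trans _ lt) // mass_ge0.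
  apply: eq_Ex => l _; rewrite /f [in RHS]eq_sym (can2_eq (mulKg _) (mulVKg _)).
  by case: eqP => [->|]; rewrite ?mulr0 // mulr1.
rewrite -ExB; apply: le_Ex => [s|l szl]; first exact: ltW.
have m0 := mass_word_gt0 szl; have := massS_ge n t (word x l).
rewrite /D; move: (mass _ _) (mass _ _) m0 => b a a0 ab.
have b0 : 0 < b by apply: lt_le_trans ab; rewrite mulr_gt0.
have lnab : ln (a / b) <= a / b - 1.
  by rewrite -[X in ln X](subrK 1) addrC le_ln1Dx // ltrBrDr addNr divr_gt0.
have abE : a / b = (b / a)^-1 by rewrite invf_div.
move: lnab; rewrite abE; have := divr_gt0 b0 a0; have : u t <= b / a by rewrite ler_pdivlMr.
have := u0 t; have -> : (b < a) = (b / a < 1) by rewrite ltr_pdivrMr // mul1r.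
move: (b / a) (u t) => r v v0 vr r0 lnr.
have rV0 : 0 < r^-1 by rewrite invr_gt0.
have rr : r * r^-1 = 1 by rewrite divff // gt_eqF.
case: ltP => r1; rewrite /= ?mulr1n ?mulr0n ?(mul0r, mul1r, subr0).
  apply: le_trans (_ : v * (r^-1 - 1) <= _); first by rewrite ler_pM2l.
  have rV1 : 1 <= r^-1 by rewrite invf_ge1 // ltW.
  have : 0 <= (r - v) * (r^-1 - 1) by apply: mulr_ge0; rewrite subr_ge0.
  move: (r^-1) rr => i rr; nra.
have : r^-1 <= 1 by rewrite invf_le1.
nra.
Qed.

End Entropy.

(** * Lazy walks *)

Section LazyOperator.
Variables (R : realType) (X : Type) (V : finType) (v : V -> R) (m : X -> V -> X).
Local Open Scope ring_scope.
Implicit Types (f : X -> R) (y : X) (n : nat).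

Definition avg f y : R := \sum_t v t * f (m y t).

Definition lazy f y : R := (f y + avg f y) / 2.

Lemma binw_rec n k : binw R n.+1 k.+1 = (binw R n k + binw R n k.+1) / 2.
Proof.
rewrite /binw binS natrD exprSr invfM mulrA -mulrDl addrC.
by rewrite mulrAC.
Qed.

Lemma binw0 n : binw R n.+1 0 = binw R n 0 / 2.
Proof. by rewrite /binw !bin0 exprSr invfM mulrA. Qed.

Lemma iter_lazy n f y :
  iter n lazy f y = \sum_(k < n.+1) binw R n k * iter k avg f y.
Proof.
elim: n y => [|n IH] y.
  by rewrite big_ord1 /binw /= bin0 expr0 divr1 mul1r.
rewrite iterS /lazy IH.
have -> : avg (iter n lazy f) y = \sum_(k < n.+1) binw R n k * iter k.+1 avg f y.
  rewrite /avg; under eq_bigr do rewrite IH mulr_sumr.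
  rewrite exchange_big; apply: eq_bigr => k _; rewrite iterS /avg mulr_sumr.
  by apply: eq_bigr => t _; rewrite mulrCA.
rewrite [RHS]big_ord_recl binw0 [in LHS]big_ord_recl /=.
under [X in _ = _ + X]eq_bigr do rewrite binw_rec.
have -> : \sum_(i < n.+1) (binw R n i + binw R n i.+1) / 2 * iter i.+1 avg f y =
  (\sum_(i < n.+1) binw R n i * iter i.+1 avg f y) / 2 +
  (\sum_(i < n.+1) binw R n i.+1 * iter i.+1 avg f y) / 2.
  rewrite !mulr_suml -big_split; apply: eq_bigr => i _ /=; ring.
have bn : binw R n n.+1 = 0 by rewrite /binw bin_small ?mul0r.
rewrite [X in _ = _ + (_ + X / 2)]big_ord_recr /= bn mul0r addr0.
move: (\sum_(i < n) _) (\sum_(i < n.+1) _) => a b; ring.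
Qed.

Hypotheses (v0 : forall t, 0 <= v t) (v1 : \sum_t v t = 1).

Lemma iter_avg01 n f : (forall y, 0 <= f y <= 1) -> forall y, 0 <= iter n avg f y <= 1.
Proof.
move=> f01; elim: n => //= n IH y; rewrite sumr_ge0 /=; last first.
  by move=> t _; rewrite mulr_ge0 //; case/andP: (IH (m y t)).
rewrite -v1; apply: ler_sum => t _; rewrite ler_piMr //.
by case/andP: (IH (m y t)).
Qed.

(** As [lazy f - f] is half of [avg f - f], the difference is half of a sum of consecutive
    differences of the iterates of [avg] against binomial weights. *)
Lemma iter_lazy_diff_le n f y : (forall y, 0 <= f y <= 1) ->
  iter n.+1 lazy f y - iter n lazy f y <= invsqrt R n.
Proof.
move=> f01; rewrite iterSr !iter_lazy -sumrB.
have f01' k := iter_avg01 k f01 y.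
apply: le_trans (_ : (\sum_(k < n.+1) binw R n k * (iter k.+1 avg f y - iter k avg f y)) / 2 <= _).
  rewrite mulr_suml le_eqVlt; apply/orP; left; apply/eqP.
  apply: eq_bigr => k _; rewrite -mulrBr -mulrA; congr (_ * _).
  have -> : iter k avg (lazy f) y = (iter k avg f y + iter k.+1 avg f y) / 2.
    elim: (k : nat) y {f01'} => [//|j IH] y.
    transitivity (\sum_t v t * iter j avg (lazy f) (m y t)); first by [].
    transitivity ((\sum_t v t * iter j avg f (m y t) +
      \sum_t v t * iter j.+1 avg f (m y t)) / 2); last by [].
    rewrite -big_split mulr_suml.
    by apply: eq_bigr => t _; rewrite IH /=; ring.
  by field.
have := binw_diff_le n f01'; have := invsqrt_gt0 R n; lra.
Qed.

Lemma iter_lazy_dist_le n f y : (forall y, 0 <= f y <= 1) ->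
  `|iter n.+1 lazy f y - iter n lazy f y| <= invsqrt R n.
Proof.
move=> f01; rewrite ler_norml iter_lazy_diff_le // andbT lerNl opprB.
have := @iter_lazy_diff_le n (fun y => 1 - f y) y.
have comp k z : iter k lazy (fun y => 1 - f y) z = 1 - iter k lazy f z.
  elim: k z => //= k IH z; rewrite /lazy IH.
  have -> : avg (iter k lazy (fun y => 1 - f y)) z = 1 - avg (iter k lazy f) z.
    rewrite /avg -[in RHS]v1 -sumrB; apply: eq_bigr => t _.
    by rewrite IH mulrBr mulr1.
  by field.
rewrite !comp => /(_ _); have -> : 1 - iter n.+1 lazy f y - (1 - iter n lazy f y) =
  iter n lazy f y - iter n.+1 lazy f y by ring.
by apply=> z; have := f01 z; lra.
Qed.

End LazyOperator.

Section LazyStep.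
Variables (R : realType) (G : groupType) (U : finType) (u : U -> R) (x : U -> G).
Variable t0 : U.
Local Open Scope ring_scope.
Hypotheses (u0 : forall t, 0 <= u t) (u1 : \sum_t u t = 1).
Hypotheses (x0 : x t0 = 1%g) (u2 : 1 / 2 <= u t0).

Lemma iter_step_dist_le n f y : (forall y, 0 <= f y <= 1) ->
  `|iter n.+1 (step u x) f y - iter n (step u x) f y| <= invsqrt R n.
Proof.
(* Since [u t0] is at least 1/2, this is a probability, and the walk of [u] is its lazy version. *)
pose v t := 2 * u t - (t == t0)%:R.
have E : step u x = lazy v (fun g t => g * x t)%g.
  apply/funext => h; apply/funext => g; rewrite /lazy /avg /v /step.
  under [X in _ + X]eq_bigr do rewrite mulrBl.
  rewrite sumrB [X in _ - X](bigD1 t0) //= [X in _ - (_ + X)]big1.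
    rewrite eqxx x0 mulg1 mul1r addr0 addrC subrK mulr_suml.
    by apply: eq_bigr => t _; field.
  by move=> t /negPf->; rewrite mul0r.
rewrite E; apply: iter_lazy_dist_le => [t|].
  rewrite /v; case: eqP => [->|_]; rewrite /= ?mulr1n ?mulr0n.
    by move: u2; lra.
  by have := u0 t; lra.
rewrite /v sumrB -mulr_sumr u1 (bigD1 t0) //= eqxx big1 => [|t /negPf-> //].
by rewrite /= mulr1n; ring.
Qed.

End LazyStep.

(** * Transience in rank three *)

Section Green.
Variables (R : realType) (Z : zmodType).
Local Open Scope ring_scope.

Definition trans (U : finType) (w : U -> R) (k : U -> Z) : (Z -> R) -> Z -> R :=
  avg w (fun y t => y + k t).

Lemma transC (U V : finType) (w : U -> R) (k : U -> Z) (w' : V -> R) (k' : V -> Z) f :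
  trans w k (trans w' k' f) = trans w' k' (trans w k f).
Proof.
apply/funext => y; rewrite /trans /avg; under eq_bigr do rewrite mulr_sumr.
rewrite exchange_big; apply: eq_bigr => t _; rewrite mulr_sumr.
by apply: eq_bigr => s _; rewrite mulrCA addrAC.
Qed.

Lemma iter_transC (U V : finType) (w : U -> R) (k : U -> Z) (w' : V -> R) (k' : V -> Z) f m :
  iter m (trans w k) (trans w' k' f) = trans w' k' (iter m (trans w k) f).
Proof. by elim: m => //= m ->; rewrite transC. Qed.

Variables (U : finType) (w : U -> R) (k : U -> Z).
Hypotheses (w0 : forall t, 0 <= w t) (w1 : \sum_t w t = 1).
Variables (v1 v2 v3 : Z).
Hypothesis free_v : injective (fun n : nat * nat * nat =>
  v1 *+ n.1.1 + v2 *+ n.1.2 + v3 *+ n.2).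
Variable D : bool * bool * bool -> U.
Hypothesis kD : forall b, k (D b) = v1 *+ b.1.1 + v2 *+ b.1.2 + v3 *+ b.2.
Variable c : R.
Hypotheses (c0 : 0 < c) (wD : forall b, c <= w (D b)).

Let pi := trans w k.

Let half (v : Z) : (Z -> R) -> Z -> R := lazy (fun _ : unit => 1) (fun y _ => y + v).

Let half_trans v : half v = trans (fun _ : bool => 1 / 2) (fun b : bool => v *+ b).
Proof.
apply/funext => f; apply/funext => y.
rewrite /half /trans /lazy /avg !big_bool /= mulr1n mulr0n addr0 (bigD1 tt) //=.
by rewrite big1 => [|[]//]; field.
Qed.

Let halfE v f y : half v f y = (f y + f (y + v)) / 2.
Proof. by rewrite /half /lazy /avg (bigD1 tt) //= big1 => [|[]//]; rewrite mul1r addr0. Qed.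

Let iter_halfE v n f y :
  iter n (half v) f y = \sum_(i < n.+1) binw R n i * f (y + v *+ i).
Proof.
rewrite iter_lazy; apply: eq_bigr => i _; congr (_ * _).
elim: (i : nat) y => [|j IH] y; first by rewrite mulr0n addr0.
by rewrite iterS /avg (bigD1 tt) //= big1 => [|[]//]; rewrite IH mul1r addr0 mulrS addrA.
Qed.

Let kappa (f : Z -> R) := half v1 (half v2 (half v3 f)).

Let iter_kappaE n f :
  iter n kappa f = iter n (half v1) (iter n (half v2) (iter n (half v3) f)).
Proof.
have comm u v m g : iter m (half u) (half v g) = half v (iter m (half u) g).
  by rewrite !half_trans iter_transC.
by elim: n => //= n ->; rewrite /kappa !comm.
Qed.

(** The lazy walks along the three vectors commute, so the weights are products of three binomial
    weights, and by freeness at most one triple reaches the given point. *)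
Let kappa_delta_le n (x y : Z) :
  iter n kappa (fun z => (z == y)%:R) x <= invsqrt R n ^+ 3.
Proof.
rewrite iter_kappaE iter_halfE.
have b0 := ltW (invsqrt_gt0 R n).
apply: (@le_trans _ _ (\sum_(i < n.+1) \sum_(j < n.+1) \sum_(l < n.+1)
   invsqrt R n ^+ 3 * (v1 *+ i + v2 *+ j + v3 *+ l == y - x)%:R)).
  apply: ler_sum => i _; rewrite iter_halfE mulr_sumr; apply: ler_sum => j _.
  rewrite iter_halfE !mulr_sumr; apply: ler_sum => l _.
  rewrite [X in _ <= _ * (X == _)%:R](_ : _ = x + v1 *+ i + v2 *+ j + v3 *+ l - x); last first.
    by rewrite [RHS]addrC !addrA addNr add0r.
  rewrite (inj_eq (addIr _)) 2!mulrA ler_wpM2r ?ler0n // exprS expr2 [leRHS]mulrA.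
  apply: ler_pM; rewrite ?mulr_ge0 ?binw_ge0 ?binw_le //.
  by apply: ler_pM; rewrite ?binw_ge0 ?binw_le.
under eq_bigr do rewrite pair_bigA.
rewrite pair_bigA /= -mulr_sumr ler_piMr ?exprn_ge0 //.
pose h (p : 'I_n.+1 * ('I_n.+1 * 'I_n.+1)) := v1 *+ p.1 + v2 *+ p.2.1 + v3 *+ p.2.2.
have h_inj : injective h.
  move=> [i [j l]] [i' [j' l']].
  move=> /(@free_v (i : nat, j : nat, l : nat) (i' : nat, j' : nat, l' : nat)).
  by move=> -[/val_inj-> /val_inj-> /val_inj->].
have [p /eqP hp|nop] := pickP (fun p => h p == y - x).
  rewrite (bigD1 p) //= [X in (X == _)%:R]hp eqxx big1 ?addr0 // => q qp.
  by rewrite -hp (inj_eq h_inj) (negPf qp).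
by rewrite big1 // => p _; have := nop p; rewrite /h => ->.
Qed.

(** [D] may take the same value several times, so the mass [c / 8] taken out for each [b] is counted
    with multiplicity. *)
Let cnt t : nat := #|[pred b | D b == t]|.
Let rest t := w t - c / 8 * (cnt t)%:R.

Let rest_ge0 t : 0 <= rest t.
Proof.
rewrite /rest subr_ge0; have [b Db|nob] := pickP (fun b => D b == t).
  apply: (@le_trans _ _ c); last by move/eqP: Db <-.
  have : (cnt t <= 8)%N by apply: leq_trans (max_card _) _; rewrite !card_prod card_bool.
  rewrite -(ler_nat R); move: (cnt t)%:R => z; have := c0; nra.
by rewrite /cnt eq_card0 ?mulr0.
Qed.

Let sum_cnt (F : U -> R) : \sum_t (cnt t)%:R * F t = \sum_b F (D b).
Proof.
rewrite (partition_big D predT) //=; apply: eq_bigr => t _.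
rewrite /cnt -sum1_card natr_sum mulr_suml; apply: eq_bigr => b /eqP->.
by rewrite mul1r.
Qed.

Let sum_rest : \sum_t rest t = 1 - c.
Proof.
have e : \sum_t (cnt t)%:R = 8 :> R.
  under eq_bigr do rewrite -[_%:R]mulr1.
  by rewrite sum_cnt sumr_const !card_prod card_bool.
by rewrite sumrB w1 -mulr_sumr e; field.
Qed.

Let pi_split f y : pi f y = c * kappa f y + trans rest k f y.
Proof.
have -> : kappa f y = (\sum_b f (y + k (D b))) / 8.
  under eq_bigr do rewrite kD.
  transitivity ((\sum_b1 \sum_b2 \sum_b3
    f (y + (v1 *+ nat_of_bool b1 + v2 *+ nat_of_bool b2 + v3 *+ nat_of_bool b3))) / 8).
    rewrite !big_bool /kappa !halfE /= !(mulr1n, mulr0n, addr0, add0r, addrA).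
    by field.
  by rewrite pair_bigA pair_bigA.
rewrite -(sum_cnt (fun t => f (y + k t))) mulrA mulrAC mulr_sumr -big_split.
by apply: eq_bigr => t _ /=; rewrite /rest; ring.
Qed.

Let iter_pi_lin m a b f g x :
  iter m pi (fun y => a * f y + b * g y) x = a * iter m pi f x + b * iter m pi g x.
Proof.
elim: m x => //= m IH x; rewrite /pi /trans /avg !mulr_sumr -big_split.
by apply: eq_bigr => t _; rewrite IH /=; ring.
Qed.

(* The mean of [invsqrt R (j + J) ^+ 3], where [J] is binomial of parameters [m] *)
(* and [c].                                                                      *)
Fixpoint binmix m j : R :=
  if m is m'.+1 then c * binmix m' j.+1 + (1 - c) * binmix m' j
  else invsqrt R j ^+ 3.

Let c1 : c <= 1.
Proof. by rewrite -subr_ge0 -sum_rest sumr_ge0. Qed.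

Let iter_pi_kappa_le m j x y :
  iter m pi (iter j kappa (fun z => (z == y)%:R)) x <= binmix m j.
Proof.
elim: m j x => [|m IH] j x; first exact: kappa_delta_le.
rewrite iterSr; set f := iter j kappa _.
have -> : pi f = (fun z => c * kappa f z + 1 * trans rest k f z).
  by apply/funext => z; rewrite pi_split mul1r.
rewrite iter_pi_lin mul1r /=; apply: lerD.
  by rewrite ler_pM2l //; exact: (IH j.+1).
rewrite iter_transC -sum_rest mulr_suml; apply: ler_sum => t _.
by apply: ler_wpM2l; [exact: rest_ge0|exact: IH].
Qed.

(** The bracket dominates the sum of all [invsqrt R i ^+ 3] with i at least j, by telescoping
    [invsqrt_cube_le]; each i is held for 1/c steps on average. *)
Let sum_binmix_le n j :
  \sum_(m < n) binmix m j <= c^-1 * (invsqrt R j ^+ 3 + 2 * invsqrt R j).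
Proof.
have I0 i := invsqrt_gt0 R i.
elim: n j => [|n IH] j.
  by rewrite big_ord0 mulr_ge0 ?invr_ge0 ?addr_ge0 ?mulr_ge0 ?exprn_ge0 // ltW.
rewrite big_ord_recl /=.
have -> : \sum_(i < n) (c * binmix i j.+1 + (1 - c) * binmix i j) =
  c * \sum_(i < n) binmix i j.+1 + (1 - c) * \sum_(i < n) binmix i j.
  by rewrite !mulr_sumr -big_split.
have {IH} := (IH j, IH j.+1) => -[IH1 IH2].
have := ler_wpM2l (ltW c0) IH2; rewrite mulVKf ?gt_eqF // => {}IH2.
have c1' : 0 <= 1 - c by rewrite subr_ge0.
have {c1'} := ler_wpM2l c1' IH1; rewrite [leRHS]mulrA => {}IH1.
have h := invsqrt_cube_le R j.
have -> : c^-1 * (invsqrt R j ^+ 3 + 2 * invsqrt R j) =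
  (invsqrt R j ^+ 3 + 2 * invsqrt R j) + (1 - c) * c^-1 * (invsqrt R j ^+ 3 + 2 * invsqrt R j).
  by have := c0; move: (invsqrt R j) => a c0'; field; rewrite gt_eqF.
lra.
Qed.

(* A step is a lazy step along the [v]'s with probability [c]; the sum over [m] *)
(* of the probability of exactly [j] such steps among [m] is [1 / c].          *)
Lemma green_le n x y :
  \sum_(m < n) iter m (trans w k) (fun z => (z == y)%:R) x <= 3 / c.
Proof.
apply: (@le_trans _ _ (\sum_(m < n) binmix m 0)).
  by apply: ler_sum => m _; exact: (iter_pi_kappa_le m 0).
apply: le_trans (sum_binmix_le n 0) _.
by rewrite /invsqrt sqrtr1 invr1 expr1n mulr1 mulrC ler_pM2r ?invr_gt0.
Qed.

End Green.

(** * Lower bound on the entropy *)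

Section EntropyLowerBound.
Variables (R : realType) (G : groupType) (U : finType) (u : U -> R) (x : U -> G).
Local Open Scope ring_scope.
Hypotheses (u0 : forall t, 0 < u t) (u1 : \sum_t u t = 1).

(** Gibbs' inequality: [ln r <= r - 1] for r the mass of the endpoint times [2 ^+ lam l]. Exchanging
    two independent copies of the word shows that the mean of r is at most 1. *)
Lemma Entn_ge n (lam : seq U -> nat) :
  (forall y, Ex u n (fun l => 2 ^+ lam l * (word x l == y)%:R) <= 1) ->
  ln 2 * Ex u n (fun l => (lam l)%:R) <= Entn u x n.
Proof.
move=> le1; rewrite EntnE // -subr_ge0 -ExZ -ExB.
have u0' t : 0 <= u t := ltW (u0 t).
apply: (@le_trans _ _ (Ex u n (fun l => 1 - mass u x n (word x l) * 2 ^+ lam l))).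
  rewrite ExB Ex_const // subr_ge0 -[leRHS](Ex_const n _ u1).
  under eq_Ex do rewrite massE // -ExZr.
  rewrite Ex_exchange; apply: le_Ex => // l' _; apply: le_trans (le1 (word x l')).
  by apply: le_Ex => // l _; rewrite mulrC eq_sym.
apply: le_Ex => // l szl.
have m0 : 0 < mass u x n (word x l) by exact: mass_word_gt0.
have p0 : 0 < 2 ^+ lam l :> R by rewrite exprn_gt0.
have := @le_ln1Dx R (mass u x n (word x l) * 2 ^+ lam l - 1).
rewrite (addrC 1) subrK lnM ?posrE // lnXn // -mulr_natr => h.
have := h _; rewrite ltrBrDr addNr mulr_gt0 // => /(_ isT); lra.
Qed.

End EntropyLowerBound.

(** * Independent coins *)

Section Coins.
Variable R : realType.
Local Open Scope ring_scope.

Definition agree_off (m c c' : seq bool) : Prop :=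
  forall i, ~~ nth false m i -> nth false c i = nth false c' i.

(** An unmarked first coin is averaged over; a marked one makes the events for its two values
    disjoint, and their union again satisfies the hypothesis. *)
Lemma coins_le n (m : seq bool) (Phi : pred (seq bool)) :
  size m = n ->
  (forall c c', size c = n -> size c' = n -> Phi c -> Phi c' ->
     agree_off m c c' -> c = c') ->
  Ex (fun _ : bool => 1 / 2 : R) n (fun c => (Phi c)%:R) <= (2 ^+ count id m)^-1.
Proof.
elim: n m Phi => [|n IH] m Phi.
  move=> /size0nil -> _ /=; rewrite expr0 invr1.
  by case: (Phi _); rewrite /= ?mulr1n ?mulr0n ?lexx ?ler01.
case: m => // a m [szm] inj; rewrite /= big_bool /=.
have inj_head b : Ex (fun _ : bool => 1 / 2 : R) n
    (fun c => (Phi (b :: c))%:R) <= (2 ^+ count id m)^-1.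
  apply: (IH m (fun c => Phi (b :: c))) => // c c' sc sc' pc pc' ag.
  suff [] : b :: c = b :: c' by [].
  by apply: inj; rewrite /= ?sc ?sc' // => -[|i] //= /ag.
case: a inj => /= inj; last first.
  by rewrite add0n; have := inj_head true; have := inj_head false; lra.
have -> : (2 ^+ (1 + count id m))^-1 = 1 / 2 * (2 ^+ count id m)^-1 :> R.
  by rewrite add1n exprS invfM div1r.
rewrite -mulrDr ler_pM2l ?divr_gt0 // -ExD.
apply: (@le_trans _ _ (Ex (fun _ : bool => 1 / 2 : R) n
    (fun c => (Phi (true :: c) || Phi (false :: c))%:R))).
  apply: le_Ex => [_|c szc]; first by rewrite divr_ge0.
  case pt : (Phi (true :: c)); case pf : (Phi (false :: c));
    rewrite /= ?mulr1n ?mulr0n ?addr0 ?add0r //.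
  suff : true :: c = false :: c by [].
  by apply: inj => //=; rewrite ?szc // => -[|i].
apply: IH => // c c' sc sc' /orP pc /orP pc' ag.
have [b pb] : exists b, Phi (b :: c) by case: pc; [exists true|exists false].
have [b' pb'] : exists b, Phi (b :: c') by case: pc'; [exists true|exists false].
suff [_ ->] : b :: c = b' :: c' by [].
by apply: inj; rewrite /= ?sc ?sc' // => -[|i] //= /ag.
Qed.

End Coins.

Lemma big_option (V : nmodType) (T : finType) (F : option T -> V) :
  (\sum_o F o = F None + \sum_t F (Some t))%R.
Proof.
rewrite (bigD1 None) //= (reindex_omap Some id) /= => [|[]//].
by congr (_ + _)%R; apply: eq_bigl => t; rewrite eqxx.
Qed.

(** * Switches at distinct positions *)

Section Switches.
Variables (R : realType) (G : groupType) (Z : zmodType) (A : comPzRingType).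
Variables (K : G -> Z) (chi : Z -> A) (up : G -> A).
Local Open Scope ring_scope.
Hypothesis KM : forall g h, K (g * h)%g = K g + K h.
Hypothesis upM : forall g h, up (g * h)%g = up g * chi (K h) + up h.

Variables (T : finType) (w : T -> R) (x : T -> G).
Hypotheses (w0 : forall t, 0 < w t) (w1 : \sum_t w t = 1).
Variables (D : bool -> T) (s : R).
Hypotheses (s0 : 0 < s) (sD : forall b, s < w (D b)).
Hypothesis KD : K (x (D false)) = K (x (D true)).

Let q := up (x (D true)) - up (x (D false)).

Variable C : finType.
Variable cl : Z -> C.
Hypothesis sep : forall r : seq Z, uniq r -> forall kappa, {in r, forall k, cl k = kappa} ->
  forall c c' : Z -> bool,
  \sum_(k <- r) (q * chi k) *+ c k = \sum_(k <- r) (q * chi k) *+ c' k ->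
  {in r, c =1 c'}.

Variable Gamma : R.
Hypothesis green : forall n y z,
  \sum_(m < n) iter m (trans w (fun t => K (x t))) (fun k => (k == z)%:R) y <= Gamma.

(* [None] is a switch, at which a fair coin chooses between [D true] and        *)
(* [D false].                                                                   *)
Let v (o : option T) : R :=
  if o is Some t then w t - s / 2 * ((t == D true)%:R + (t == D false)%:R) else s.

Let elt (ob : option T * bool) : G := x (if ob.1 is Some t then t else D ob.2).

Let disp (o : option T) : Z := K (elt (o, true)).

Let v_gt0 o : 0 < v o.
Proof.
case: o => //= t; have := w0 t; have := sD true; have := sD false.
case: eqP => [->|_]; case: eqP => [->|_]; rewrite /= ?mulr1n ?mulr0n; have := s0; lra.
Qed.

Let sum_delta (F : T -> R) b : \sum_t (t == D b)%:R * F t = F (D b).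
Proof.
rewrite (bigD1 (D b)) //= eqxx mul1r big1 ?addr0 // => t /negPf->.
by rewrite mul0r.
Qed.

Let sum_v (F : option T -> R) : \sum_o v o * F o =
  \sum_t w t * F (Some t) + s * F None - s / 2 * (F (Some (D true)) + F (Some (D false))).
Proof.
rewrite big_option -(sum_delta (fun t => F (Some t)) true) -(sum_delta (fun t => F (Some t)) false).
rewrite -big_split mulr_sumr addrAC -sumrB addrC; congr (_ + _).
by apply: eq_bigr => t _ /=; ring.
Qed.

Let sum_v1 : \sum_o v o = 1.
Proof.
have := sum_v (fun=> 1); under eq_bigr do rewrite mulr1.
by under [X in _ = X + _ - _ -> _]eq_bigr do rewrite mulr1; move=> ->; rewrite w1; field.
Qed.

(** The mass [s] of the switch is taken equally from [D true] and [D false], and the fair coin gives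
    it back equally. *)
Let step_switch : step w x = step (fun ob => v ob.1 * (1 / 2)) elt.
Proof.
apply/funext => f; apply/funext => g; rewrite /step.
transitivity (\sum_o \sum_(b : bool) v o * (1 / 2) * f (g * elt (o, b))%g); last first.
  by rewrite pair_bigA; apply: eq_bigr => -[o b] _.
under [RHS]eq_bigr do rewrite big_bool /= -mulrDr -mulrA.
rewrite sum_v /elt /=.
have -> : \sum_t w t * (1 / 2 * (f (g * x t)%g + f (g * x t)%g)) = \sum_t w t * f (g * x t)%g.
  by apply: eq_bigr => t _; field.
by field.
Qed.

Let trans_switch : trans v disp = trans w (fun t => K (x t)).
Proof.
apply/funext => f; apply/funext => y; rewrite /trans /avg sum_v /disp /elt /= KD.
by field.
Qed.

Let Ksum (z : seq (option T)) : Z := foldr (fun o k => disp o + k) 0 z.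

(* The displacements accumulated after each switch: by [upM], the switch with   *)
(* coin [b] contributes [up (x (D b)) * chi k] to [up] of the whole word, where *)
(* [k] is its position.                                                         *)
Fixpoint pos (z : seq (option T)) : seq Z :=
  if z is o :: z' then (if o is None then Ksum z' :: pos z' else pos z') else [::].

(* The last switch at each position of class [kappa]. *)
Fixpoint sel kappa (z : seq (option T)) : seq bool :=
  if z is o :: z' then
    ((o == None) && (Ksum z' \notin pos z') && (cl (Ksum z') == kappa)) :: sel kappa z'
  else [::].

Fixpoint coin (z : seq (option T)) (c : seq bool) (k : Z) : bool :=
  match z, c with
  | o :: z', b :: c' => if (o == None) && (Ksum z' \notin pos z') && (k == Ksum z') then b
                        else coin z' c' k
  | _, _ => false
  end.

Let sites kappa z := [seq k <- undup (pos z) | cl k == kappa].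

Let size_sel kappa z : size (sel kappa z) = size z.
Proof. by elim: z => //= o z ->. Qed.

Let count_sel kappa z : count id (sel kappa z) = size (sites kappa z).
Proof.
elim: z => //= o z ->; rewrite /sites; case: o => [t|] //=.
case: ifP => //= _; by case: ifP.
Qed.

Let K_word z c : size c = size z -> K (word elt (zip z c)) = Ksum z.
Proof.
have K1 : K 1%g = 0 by apply: (addIr (K 1%g)); rewrite -KM mul1g add0r.
elim: z c => [|o z IH] [|b c] //= [/IH <-]; rewrite KM; congr (_ + _).
by rewrite /disp /elt /=; case: o b => [t|] [].
Qed.

(** Apart from the selected switches, everything in [up] depends only on the coins off
    [sel kappa z]: displacements do not see the coins, by [KD]. The selected contributions are moved
    across to avoid subtraction. *)
Let up_word kappa z c c' : size c = size z -> size c' = size z ->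
  agree_off (sel kappa z) c c' ->
  up (word elt (zip z c)) + \sum_(k <- sites kappa z) (q * chi k) *+ coin z c' k =
  up (word elt (zip z c')) + \sum_(k <- sites kappa z) (q * chi k) *+ coin z c k.
Proof.
elim: z c c' => [|o z IH] [|b c] [|b' c'] //= [szc] [szc'] ag.
have {}IH := IH c c' szc szc' (fun i => ag i.+1).
rewrite !upM !K_word //; case: o ag => [t|] /= ag; first by rewrite -!addrA IH.
have siteE : sites kappa (None :: z) =
    if (Ksum z \notin pos z) && (cl (Ksum z) == kappa) then Ksum z :: sites kappa z
    else sites kappa z.
  by rewrite /sites /=; case: ifP => //= _; case: ifP.
have coinE d b0 : {in sites kappa z, forall k,
    (if (Ksum z \notin pos z) && (k == Ksum z) then b0 else coin z d k) = coin z d k}.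
  move=> k; rewrite mem_filter mem_undup => /andP[_ kz].
  by case: eqP => [<-|]; rewrite ?kz ?andbF.
have sumE d b0 : \sum_(k <- sites kappa z) (q * chi k) *+
    (if (Ksum z \notin pos z) && (k == Ksum z) then b0 else coin z d k) =
    \sum_(k <- sites kappa z) (q * chi k) *+ coin z d k.
  by apply: eq_big_seq => k kz; rewrite coinE.
rewrite siteE; case: ifP => [/andP[nz kz]|nsel].
  rewrite !big_cons nz eqxx /= in sumE *; rewrite !sumE.
  rewrite addrACA IH [RHS]addrACA; congr (_ + _).
  rewrite /elt /q; case: b {ag} => /=; case: b' => //=; rewrite ?mulr1n ?mulr0n ?addr0.
    by rewrite mulrBl addrC subrK.
  by rewrite mulrBl addrC subrK.
have -> : b = b' by apply: (ag 0%N); rewrite /= nsel.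
by rewrite !sumE -!addrA IH.
Qed.

Let coin_inj kappa z c c' : size c = size z -> size c' = size z ->
  agree_off (sel kappa z) c c' ->
  {in sites kappa z, coin z c =1 coin z c'} -> c = c'.
Proof.
elim: z c c' => [|o z IH] [|b c] [|b' c'] //= [szc] [szc'] ag eqc.
have cc' : c = c'.
  apply: IH (fun i => ag i.+1) _ => // k kz.
  have := eqc k; rewrite /sites /=.
  move: kz; rewrite mem_filter mem_undup => /andP[clk kz].
  have -> : (o == None) && (Ksum z \notin pos z) && (k == Ksum z) = false.
    by case: (k =P Ksum z) => [<-|_]; rewrite ?kz ?andbF.
  apply; rewrite mem_filter clk; case: o {ag eqc} => [t|]; rewrite mem_undup //.
  by rewrite inE kz orbT.
rewrite -cc' in ag eqc *; congr (_ :: _).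
have [/andP[/andP[/eqP oN nz] kz]|nsel] :=
  boolP ((o == None) && (Ksum z \notin pos z) && (cl (Ksum z) == kappa)); last first.
  by apply: (ag 0%N); rewrite /= nsel.
have := eqc (Ksum z); rewrite oN nz eqxx /=; apply.
by rewrite mem_filter kz /= (negPf nz) inE eqxx.
Qed.

(** Once [z] and the unselected coins are fixed, the endpoint determines the selected coins by
    [up_word] and [sep]. *)
Let coins_word_le kappa z y :
  Ex (fun _ : bool => 1 / 2 : R) (size z) (fun c => (word elt (zip z c) == y)%:R)
  <= (2 ^+ size (sites kappa z))^-1.
Proof.
rewrite -count_sel; apply: coins_le (size_sel kappa z) _ => c c' szc szc' /eqP wy /eqP wy' ag.
apply: (coin_inj szc szc' ag); apply: (@sep _ _ kappa).
- by rewrite filter_uniq ?undup_uniq.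
- by move=> k; rewrite mem_filter => /andP[/eqP].
by have := up_word szc szc' ag; rewrite wy wy' => /addrI.
Qed.

Fixpoint hits (y : Z) (z : seq (option T)) : nat :=
  if z is o :: z' then (((o == None) && (y + disp o == 0)%R) + hits (y + disp o)%R z')%N else 0%N.

(** [pos] records the displacement after a switch and [hits] the one up to and including it, offset
    by [y]; without the offset the two add up to [Ksum z]. Repeated positions thus become returns of
    a walk to 0. *)
Let count_pos y z : count_mem (Ksum z + y) (pos z) = hits y z.
Proof.
elim: z y => [|o z IH] y //=.
have -> : disp o + Ksum z + y = Ksum z + (y + disp o) by rewrite -addrA addrCA (addrC y).
case: o => [t|] /=; rewrite IH // -[X in X == _]addr0 (inj_eq (addrI _)).
by rewrite [0 == _]eq_sym.
Qed.

Let Ex_hits n y :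
  Ex v n (fun z => (hits y z)%:R) =
  s * \sum_(m < n) iter m (trans v disp) (fun k => (k == - disp None)%:R) y.
Proof.
elim: n y => [|n IH] y /=; first by rewrite big_ord0 mulr0.
rewrite big_ord_recl mulrDr /=.
have h o : Ex v n (fun z => (((o == None) && (y + disp o == 0)%R) + hits (y + disp o)%R z)%N%:R) =
    ((o == None) && (y + disp o == 0))%:R + Ex v n (fun z => (hits (y + disp o) z)%:R).
  by under eq_Ex do rewrite natrD; rewrite ExD Ex_const.
under eq_bigr do rewrite h mulrDr; rewrite big_split /=; congr (_ + _).
  rewrite (bigD1 None) //= big1 ?addr0 => [|[t|] //]; last by rewrite mulr0.
  by rewrite addr_eq0.
under eq_bigr do rewrite IH mulrCA; rewrite -mulr_sumr; congr (_ * _).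
transitivity (\sum_o \sum_(m < n) v o *
    iter m (trans v disp) (fun k : Z => (k == - disp None)%:R) (y + disp o)).
  by apply: eq_bigr => o _; rewrite mulr_sumr.
by rewrite exchange_big.
Qed.

Let ranges z : nat := size (undup (pos z)).

(** A new first letter enlarges the range when it is a switch whose position does not occur later;
    the probability that it does occur is at most the mean number of hits, hence at most
    [s * Gamma]. *)
Let Ex_ranges n : n%:R * (s * (1 - s * Gamma)) <= Ex v n (fun z => (ranges z)%:R).
Proof.
have v0 o : 0 <= v o := ltW (v_gt0 o).
elim: n => [|n IH]; first by rewrite mul0r /= lexx.
pose rec := Ex v n (fun l => (ranges l)%:R).
have rangesN : Ex v n (fun l => (ranges (None :: l))%:R) =
    Ex v n (fun l => (Ksum l \notin pos l)%:R) + rec.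
  rewrite -ExD; apply: eq_Ex => l _; rewrite /ranges /=.
  by case: (_ \in _); rewrite /= ?add0r // -natr1 addrC.
have -> : Ex v n.+1 (fun z => (ranges z)%:R) =
    s * Ex v n (fun l => (Ksum l \notin pos l)%:R) + rec.
  rewrite -[RHS]/(v None * _ + _) -[X in _ = _ + X]mul1r -[X in _ = _ + X * _]sum_v1 big_option.
  by rewrite mulrDl addrA -mulrDr -rangesN mulr_suml [LHS]big_option.
rewrite -natr1 mulrDl mul1r addrC; apply: lerD => //; rewrite ler_pM2l //.
apply: (@le_trans _ _ (Ex v n (fun l => 1 - (hits 0 l)%:R))).
  rewrite ExB Ex_const // lerB // Ex_hits trans_switch ler_pM2l //.
apply: le_Ex => // l _; rewrite -count_pos addr0.
case: (boolP (_ \in _)) => h /=; last by rewrite mulr1n lerBlDr lerDl ler0n.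
by rewrite mulr0n subr_le0 ler1n -has_count has_pred1.
Qed.

(** Each class bounds the entropy by its own number of sites, and summing over the classes recovers
    the whole range. The factor [#|C|] is the price of separating within one class only. *)
Lemma Entn_switch_ge n :
  ln 2 * (n%:R * (s * (1 - s * Gamma))) <= #|C|%:R * Entn w x n.
Proof.
have v0 o : 0 <= v o := ltW (v_gt0 o).
have ln2 : 0 <= ln 2 :> R by rewrite ln_ge0 // ler1n.
apply: le_trans (ler_wpM2l ln2 (Ex_ranges n)) _.
have -> : Ex v n (fun z => (ranges z)%:R) = \sum_kappa Ex v n (fun z => (size (sites kappa z))%:R).
  rewrite -Ex_sum; apply: eq_Ex => z _; rewrite -natr_sum; congr (_%:R).
  rewrite /ranges /sites; elim: (undup _) => [|k r IH] /=; first by rewrite big1.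
  rewrite IH (bigD1 (cl k)) //= [in RHS](bigD1 (cl k)) //= eqxx /= addSn; congr (_ + _).+1.
  by apply: eq_bigr => kappa /negPf; rewrite eq_sym => ->.
rewrite mulr_sumr -[#|C|]sum1_card natr_sum mulr_suml; apply: ler_sum => kappa _.
rewrite mul1r.
have -> : Entn w x n = Entn (fun ob : option T * bool => v ob.1 * (1 / 2)) elt n.
  by rewrite /Entn step_switch.
have h1 (ob : option T * bool) : 0 < v ob.1 * (1 / 2) by rewrite mulr_gt0.
have h2 : \sum_(ob : option T * bool) v ob.1 * (1 / 2) = 1.
  transitivity (\sum_o \sum_(b : bool) v o * (1 / 2)).
    by rewrite pair_bigA; apply: eq_bigr => -[o b].
  by rewrite -[RHS]sum_v1; apply: eq_bigr => o _; rewrite big_bool /=; field.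
have -> : Ex v n (fun z => (size (sites kappa z))%:R) =
  Ex (fun ob : option T * bool => v ob.1 * (1 / 2)) n (fun l => (size (sites kappa (unzip1 l)))%:R).
  rewrite (Ex_pair v (fun=> 1 / 2)); apply: eq_Ex => z szz.
  rewrite -[LHS](@Ex_const _ _ (fun _ : bool => 1 / 2) n); last by rewrite big_bool /=; field.
  by apply: eq_Ex => c szc; rewrite unzip1_zip // szc szz.
apply: Entn_ge => // y; rewrite (Ex_pair v (fun=> 1 / 2)) -[leRHS](Ex_const n _ sum_v1).
apply: le_Ex => // z szz.
apply: (@le_trans _ _ (2 ^+ size (sites kappa z) *
    Ex (fun _ : bool => 1 / 2 : R) n (fun c => (word elt (zip z c) == y)%:R))).
  rewrite -ExZ; apply: le_Ex => [_|c szc]; first by rewrite divr_ge0.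
  by rewrite unzip1_zip // szc szz.
have p0 : 0 < 2 ^+ size (sites kappa z) :> R by rewrite exprn_gt0.
by have := coins_word_le kappa z y; rewrite szz => /(ler_wpM2l (ltW p0)); rewrite divff ?gt_eqF.
Qed.

End Switches.

(** * Truncated walks and their harmonic limits *)

Section Compactness.
Variables (R : realType) (I : choiceType).
Local Open Scope ring_scope.
Local Open Scope classical_set_scope.

(** The limit is taken along an ultrafilter finer than [eventually]: its value at [y] is the
    supremum of the r below [a n y] for ultrafilter-many n. *)
Lemma unit_cube_compact (a : nat -> I -> R) : (forall n y, 0 <= a n y <= 1) ->
  exists2 F : I -> R, forall y, 0 <= F y <= 1 &
    forall (s : seq I) (e : R) n0, 0 < e ->
    exists2 n, (n0 <= n)%N & {in s, forall y, `|a n y - F y| < e}.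
Proof.
move=> a01.
have [U [UU sU]] := @ultraFilterLemma nat eventually _.
pose S y := [set r | 0 <= r <= 1 /\ U [set n | r <= a n y]].
have S0 y : S y 0.
  split; first by rewrite lexx ler01.
  by apply: filterS filterT => n _; case/andP: (a01 n y).
have S1 y : ubound (S y) 1 by move=> r [/andP[]].
have supS y : has_sup (S y) by split; [exists 0|exists 1].
have F01 y : 0 <= sup (S y) <= 1.
  by rewrite ub_le_sup ?ge_sup //; [exists 0|exists 1].
exists (fun y => sup (S y)) => // s e n0 e0.
have close y : U [set n | `|a n y - sup (S y)| < e].
  have [r [_ Ur] rS] := sup_adherent e0 (supS y).
  have [Ub|Ub] := in_ultra_setVsetC [set n | sup (S y) + e / 2 <= a n y] UU.
    have [n /= ln] := filter_ex Ub; have /andP[S0' _] := F01 y.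
    have : S y (sup (S y) + e / 2).
      split=> //; apply/andP; split; first by rewrite addr_ge0 // divr_ge0 // ltW.
      by apply: le_trans ln _; case/andP: (a01 n y).
    move=> /(ub_le_sup (supS y).2); lra.
  apply: filterS (filterI Ur Ub) => n /= [rn /negP]; rewrite -ltNge => nb.
  by rewrite ltr_norml; apply/andP; split; lra.
have : U [set n | (n0 <= n)%N /\ {in s, forall y, `|a n y - sup (S y)| < e}].
  elim: s => [|y s IH].
    have : U [set n | (n0 <= n)%N] by apply: sU; exists n0.
    by apply: filterS => n /= h; split.
  apply: filterS (filterI (close y) IH) => n /= [cy [n0n cs]]; split=> // z.
  by rewrite inE => /predU1P[->|/cs].
by move=> /filter_ex[n [n0n cs]]; exists n.
Qed.

End Compactness.

Section Esum.
Variables (R : realType) (I : choiceType) (a : I -> R).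
Local Open Scope ring_scope.
Local Open Scope classical_set_scope.
Hypothesis a0 : forall i, 0 <= a i.

Let fsumE (A : set I) : finite_set A ->
  (\sum_(i \in A) (a i)%:E = (\sum_(i <- fset_set A) a i)%:E)%E.
Proof. by move=> Afin; rewrite fsbig_finite // sumEFin. Qed.

Lemma esum_fsetsP (L : R) : \esum_(i in [set: I]) (a i)%:E = L%:E <->
  (forall B : {fset I}, \sum_(i <- B) a i <= L) /\
  (forall e, 0 < e -> exists B : {fset I}, L - e < \sum_(i <- B) a i).
Proof.
split=> [E|[le_L gt_L]].
  have fin (B : {fset I}) : finite_set [set` B] by exact: finite_fset.
  split=> [B|e e0].
    rewrite -lee_fin -E; apply: ereal_sup_ubound; exists [set` B].
      by split.
    by rewrite fsumE // set_fsetK.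
  have : (exists2 x, [set \sum_(x \in A) (a x)%:E | A in fsets [set: I]]%E x & (L - e)%:E < x)%E.
    apply: ereal_sup_gt; rewrite -/(esum _ _) E lte_fin; lra.
  case=> x [A [Afin _] <-]; rewrite fsumE // lte_fin => h.
  by exists (fset_set A).
apply/eqP; rewrite eq_le; apply/andP; split.
  by apply: ge_ereal_sup => _ [A [Afin _] <-]; rewrite fsumE // lee_fin.
apply/lee_addgt0Pr => e e0; have [B hB] := gt_L e e0.
have : ((\sum_(i <- B) a i)%:E <= \esum_(i in [set: I]) (a i)%:E)%E.
  apply: ereal_sup_ubound; exists [set` B]; first by split => //; exact: finite_fset.
  by rewrite fsumE ?set_fsetK //; exact: finite_fset.
move=> /(leeD2r e%:E); apply: le_trans; rewrite -EFinD lee_fin; lra.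
Qed.

Lemma sum_fset_subset (B C : {fset I}) : (B `<=` C)%fset ->
  \sum_(i <- B) a i <= \sum_(i <- C) a i.
Proof.
move=> BC; rewrite [leRHS](big_fsetID _ (mem B)) /=.
have -> : [fset x in C | x \in B]%fset = B.
  by apply/fsetP => x; rewrite !inE andbC; case: (boolP (x \in B)) => // /(fsubsetP BC).
by rewrite lerDl sumr_ge0.
Qed.

End Esum.

(** * Truncations of the measure *)

Section Truncation.
Variables (R : realType) (G : groupType) (mu : G -> R).
Local Open Scope ring_scope.
Hypothesis mu_prob : is_probability mu.

Let mu0 g : 0 <= mu g. Proof. exact: mu_prob.1. Qed.

Definition fmass (B : {fset G}) : R := \sum_(b <- B) mu b.

Lemma fmass_le1 B : fmass B <= 1.
Proof. by have [/(_ B)] := (esum_fsetsP mu 1).1 mu_prob.2. Qed.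

Lemma fmass_gt e : 0 < e -> exists B, 1 - e < fmass B.
Proof. by have [_] := (esum_fsetsP mu 1).1 mu_prob.2; apply. Qed.

Definition in_supp (B : {fset G}) : bool := [forall b : B, 0 < mu (val b)].

Lemma in_suppP B : reflect {in B, forall b, 0 < mu b} (in_supp B).
Proof.
apply: (iffP forallP) => [h b bB|h b]; first exact: (h [` bB]%fset).
exact: h (valP b).
Qed.

Lemma restrict_supp (a : G -> R) (B : {fset G}) : (forall b, mu b = 0 -> a b = 0) ->
  \sum_(b <- [fset b in B | (0 < mu b)%R]%fset) a b = \sum_(b <- B) a b.
Proof.
move=> am; apply: big_fset_incl => [|b bB]; first exact: fset_sub.
rewrite !inE bB /= -leNgt => mb; apply: am.
by apply/eqP; rewrite eq_le mb mu0.
Qed.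

Lemma fmass_gt_supp e : 0 < e -> exists2 B, in_supp B & 1 - e < fmass B.
Proof.
move=> /fmass_gt[B hB]; exists [fset b in B | (0 < mu b)%R]%fset.
  by apply/in_suppP => b; rewrite !inE => /andP[].
by rewrite /fmass restrict_supp.
Qed.

(* The law [(delta_1 + mu_B) / 2], where [mu_B] is [mu] restricted to [B] with *)
(* the missing mass moved to 1.                                                *)
Definition truncw (B : {fset G}) (o : option B) : R :=
  if o is Some b then mu (val b) / 2 else 1 - fmass B / 2.

Definition truncx (B : {fset G}) (o : option B) : G :=
  if o is Some b then val b else 1%g.

Lemma sum_truncw (B : {fset G}) (F : G -> R) :
  \sum_o @truncw B o * F (truncx o) =
  (1 - fmass B / 2) * F 1%g + (\sum_(b <- B) mu b * F b) / 2.
Proof.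
rewrite big_option /=; congr (_ + _); rewrite big_seq_fsetE /= mulr_suml.
by apply: eq_bigr => b _; rewrite mulrAC.
Qed.

Lemma truncw_gt0 B o : in_supp B -> 0 < @truncw B o.
Proof.
move=> /in_suppP Bs; case: o => [b|] /=; first by rewrite divr_gt0 // Bs // (valP b).
by have := fmass_le1 B; lra.
Qed.

Lemma truncw_ge0 B o : 0 <= @truncw B o.
Proof.
case: o => [b|] /=; first by rewrite divr_ge0.
by have := fmass_le1 B; lra.
Qed.

Lemma sum_truncw1 B : \sum_o @truncw B o = 1.
Proof.
have := @sum_truncw B (fun=> 1); under eq_bigr do rewrite mulr1.
move=> ->; under eq_bigr do rewrite mulr1.
by rewrite -/(fmass B); field.
Qed.

Lemma truncw_lazy B : 1 / 2 <= @truncw B None.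
Proof. by rewrite /=; have := fmass_le1 B; lra. Qed.

Lemma iter_trunc_dist_le B n (f : G -> R) y : (forall y, 0 <= f y <= 1) ->
  `|iter n.+1 (step (@truncw B) (@truncx B)) f y -
    iter n (step (@truncw B) (@truncx B)) f y| <= invsqrt R n.
Proof.
exact: (@iter_step_dist_le _ _ _ _ _ None (@truncw_ge0 B) (sum_truncw1 B) erefl (truncw_lazy B)).
Qed.

Lemma invsqrt_small e : 0 < e -> exists n0, forall n, (n0 <= n)%N -> invsqrt R n < e.
Proof.
move=> e0; exists (Num.truncn (e^-1 ^+ 2)) => n n0n.
rewrite /invsqrt -[ltRHS]invrK ltf_pV2 ?posrE ?invr_gt0 ?sqrtr_gt0 ?ltr0n //.
have eV0 : 0 <= e^-1 by rewrite invr_ge0 ltW.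
have -> : e^-1 = Num.sqrt (e^-1 ^+ 2) by rewrite sqrtr_sqr ger0_norm.
rewrite ltr_sqrt ?ltr0n //.
apply: lt_le_trans (real_truncnS_gt _) _; first by rewrite num_real.
by rewrite ler_nat.
Qed.

Section Limit.
Variables (B : nat -> {fset G}) (f : nat -> G -> R).
Hypotheses (fmassB : forall n, 1 - invsqrt R n < fmass (B n)).
Hypotheses (f01 : forall n y, 0 <= f n y <= 1).

Let F n := iter n (step (@truncw (B n)) (@truncx (B n))) (f n).

Let F01 n y : 0 <= F n y <= 1.
Proof. by apply: iter_step01 => //; [exact: truncw_ge0|exact: sum_truncw1]. Qed.

Let sumF n (C : {fset G}) y := \sum_(b <- C) mu b * F n (y * b)%g.

Let sumF_mono n (C D : {fset G}) y : (C `<=` D)%fset ->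
  sumF n C y <= sumF n D y <= sumF n C y + (fmass D - fmass C).
Proof.
move=> CD; have F0 z : 0 <= F n z by case/andP: (F01 n z).
apply/andP; split.
  by apply: (sum_fset_subset (a := fun b => mu b * F n (y * b)%g)) => // b; rewrite mulr_ge0.
have := sum_fset_subset (a := fun b => mu b * (1 - F n (y * b)%g)) _ CD.
under eq_bigr do rewrite mulrBr mulr1; under [leRHS]eq_bigr do rewrite mulrBr mulr1.
rewrite !sumrB => h; suff : fmass C - sumF n C y <= fmass D - sumF n D y by lra.
by apply: h => b; rewrite mulr_ge0 // subr_ge0; case/andP: (F01 n (y * b)%g).
Qed.

Variable Fl : G -> R.
Hypothesis close : forall (s : seq G) e n0, 0 < e ->
  exists2 n, (n0 <= n)%N & {in s, forall y, `|F n y - Fl y| < e}.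

(** [F n] is invariant up to [invsqrt R n] under the truncated walk, and the truncations exhaust
    [mu]; the finite sets [C] and [B n] are compared through their union. *)
Let limit_sum (C : {fset G}) y :
  Fl y - (1 - fmass C) <= \sum_(b <- C) mu b * Fl (y * b)%g <= Fl y.
Proof.
have main e : 0 < e ->
    Fl y - (1 - fmass C) - 6 * e <= \sum_(b <- C) mu b * Fl (y * b)%g <= Fl y + 6 * e.
  move=> e0; have [n0 small] := invsqrt_small e0.
  have [n n0n cl] := close (y :: [seq (y * b)%g | b <- C]) n0 e0.
  have ne := small n n0n.
  have cly : `|F n y - Fl y| < e by apply: cl; rewrite inE eqxx.
  have clC : `|sumF n C y - \sum_(b <- C) mu b * Fl (y * b)%g| <= e.
    rewrite -sumrB; apply: (le_trans (ler_norm_sum _ _ _)).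
    apply: (@le_trans _ _ (\sum_(b <- C) mu b * e)).
      rewrite big_seq [leRHS]big_seq; apply: ler_sum => b bC.
      rewrite -mulrBr normrM ger0_norm // ler_wpM2l // ltW // cl // inE.
      by rewrite map_f ?orbT.
    by rewrite -mulr_suml ler_piMl ?fmass_le1 // ltW.
  have inv : `|(sumF n (B n) y - fmass (B n) * F n y) / 2| <= e.
    apply: le_trans (ltW ne); apply: le_trans (iter_trunc_dist_le (B n) n y (f01 n)).
    rewrite iterS -/(F n) {1}/step.
    have := sum_truncw (B n) (fun h => F n (y * h)%g); rewrite mulg1 => ->.
    by rewrite /sumF le_eqVlt; apply/orP; left; apply/eqP; congr `|_|; field.
  have /andP[d1 d2] := sumF_mono n y (fsubsetUl C (B n)).
  have /andP[d3 d4] := sumF_mono n y (fsubsetUr C (B n)).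
  have mB := fmassB n; have mB1 := fmass_le1 (B n); have mU1 := fmass_le1 (C `|` B n)%fset.
  have /andP[F0 F1] := F01 n y.
  have p1 : 0 <= (1 - fmass (B n)) * (1 - F n y) by rewrite mulr_ge0 // subr_ge0.
  have p2 : 0 <= (1 - fmass (B n)) * F n y by rewrite mulr_ge0 // subr_ge0.
  move: cly clC inv; rewrite ltr_norml !ler_norml => /andP[c1 c2] /andP[c3 c4] /andP[c5 c6].
  by apply/andP; split; lra.
apply/andP; split; rewrite leNgt; apply/negP => lt.
  have e0 : 0 < (Fl y - (1 - fmass C) - \sum_(b <- C) mu b * Fl (y * b)%g) / 12 by lra.
  by have /andP[] := main _ e0; lra.
have e0 : 0 < (\sum_(b <- C) mu b * Fl (y * b)%g - Fl y) / 12 by lra.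
by have /andP[] := main _ e0; lra.
Qed.

Hypothesis Fl01 : forall y, 0 <= Fl y <= 1.

Lemma limit_harmonic y : harmonic_at mu Fl y.
Proof.
have F0 z : 0 <= Fl z by case/andP: (Fl01 z).
have f0 h : 0 <= Fl (y * h)%g * mu h by rewrite mulr_ge0.
rewrite /harmonic_at /sum_over_group.
rewrite [X in (_ - X)%E]esum1 => [|h _]; last by rewrite max_r // oppr_le0.
rewrite sube0 (eq_esum (b := fun h => (Fl (y * h)%g * mu h)%:E)) => [|h _]; last by rewrite max_l.
apply/esym/(esum_fsetsP (fun h => Fl (y * h)%g * mu h)).
have E (C : {fset G}) : \sum_(h <- C) Fl (y * h)%g * mu h = \sum_(h <- C) mu h * Fl (y * h)%g.
  by apply: eq_bigr => h _; rewrite mulrC.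
split=> [C|e e0]; first by rewrite E; case/andP: (limit_sum C y).
have [C hC] := fmass_gt e0; exists C; rewrite E; apply: lt_le_trans (andP (limit_sum C y)).1.
lra.
Qed.

End Limit.

(** For each n a truncation missing less than [invsqrt R n] of the mass and a function with gap
    [eps] at time n are chosen; a limit point of the iterates is harmonic and keeps the gap. *)
Lemma exists_harmonic g (eps : R) : 0 < eps ->
  (forall n (B0 : {fset G}), in_supp B0 -> exists B, [/\ (B0 `<=` B)%fset, in_supp B &
     exists f : G -> R, (forall y, 0 <= f y <= 1) /\
      eps <= iter n (step (@truncw B) (@truncx B)) f g -
             iter n (step (@truncw B) (@truncx B)) f 1%g]) ->
  exists F : G -> R, [/\ forall y, 0 <= F y <= 1, forall y, harmonic_at mu F y & F g <> F 1%g].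
Proof.
move=> eps0 H.
have H' n : exists Bf : {fset G} * (G -> R), [/\ 1 - invsqrt R n < fmass Bf.1,
    forall y, 0 <= Bf.2 y <= 1 &
      eps <= iter n (step (@truncw Bf.1) (@truncx Bf.1)) Bf.2 g -
             iter n (step (@truncw Bf.1) (@truncx Bf.1)) Bf.2 1%g].
  have [B0 B0s mB0] := fmass_gt_supp (invsqrt_gt0 R n).
  have [B [B0B Bs [f [f01 hf]]]] := H n B0 B0s.
  exists (B, f); split=> //=; apply: lt_le_trans mB0 _.
  exact: (sum_fset_subset (a := mu) mu0 B0B).
have [Bf HBf] := choice H'.
pose B n := (Bf n).1; pose f n := (Bf n).2.
have massB n : 1 - invsqrt R n < fmass (B n) by case: (HBf n).
have f01 n y : 0 <= f n y <= 1 by case: (HBf n) => _ /(_ y).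
pose F n := iter n (step (@truncw (B n)) (@truncx (B n))) (f n).
have F01 n y : 0 <= F n y <= 1.
  by apply: iter_step01 => //; [exact: truncw_ge0|exact: sum_truncw1].
have [Fl Fl01 close] := unit_cube_compact F01.
exists Fl; split=> // [y|FgF1]; first exact: (limit_harmonic massB f01 close Fl01).
have e4 : 0 < eps / 4 by rewrite divr_gt0.
have [n _ cl] := close [:: g; 1%g] (eps / 4) 0 e4.
have := cl g; rewrite inE eqxx => /(_ isT).
have := cl 1%g; rewrite !inE eqxx orbT => /(_ isT).
have [_ _] := HBf n; rewrite -/(f n) -/(B n) -/(F n) !ltr_norml FgF1.
by move=> h /andP[h1 h2] /andP[h3 h4]; lra.
Qed.

End Truncation.

(** * Entropy growth without bounded harmonic functions *)

Lemma sum_fset_mem (V : nmodType) (I : choiceType) (a : I -> V) (B E : {fset I}) :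
  (E `<=` B)%fset -> (\sum_(b <- B | b \in E) a b = \sum_(b <- E) a b)%R.
Proof.
move=> EB; rewrite big_mkcond /= -(big_fset_incl _ EB) => [|b _ /negPf-> //].
by apply: eq_big_seq => b ->.
Qed.

Section Triple.
Variables (R : realType) (G : groupType) (U : finType) (u : U -> R) (x : U -> G).
Local Open Scope ring_scope.

(** Three steps become one letter. With the unit as padding, [a b], [b a] and the partial products
    of [a1], [a2], [a3] are all single letters. *)
Definition triple_weight (t : U * U * U) : R := u t.1.1 * u t.1.2 * u t.2.
Definition triple_word (t : U * U * U) : G := (x t.1.1 * x t.1.2 * x t.2)%g.

Lemma step_triple : step triple_weight triple_word = iter 3 (step u x).
Proof.
apply/funext => f; apply/funext => g.
transitivity (\sum_a \sum_b \sum_c u a * u b * u c * f (g * (x a * x b * x c))%g).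
  by rewrite pair_bigA pair_bigA.
rewrite /= {1}/step; apply: eq_bigr => a _; rewrite {1}/step mulr_sumr.
apply: eq_bigr => b _; rewrite {1}/step !mulr_sumr.
by apply: eq_bigr => c _; rewrite !mulrA !mulgA.
Qed.

Lemma sum_triple_weight : \sum_t u t = 1 -> \sum_t triple_weight t = 1.
Proof.
move=> u1; transitivity (\sum_a \sum_b \sum_c u a * u b * u c).
  by rewrite pair_bigA pair_bigA.
rewrite -u1; apply: eq_bigr => a _; rewrite -[RHS]mulr1 -u1 mulr_sumr.
by apply: eq_bigr => b _; rewrite -mulr_sumr u1 mulr1.
Qed.

Lemma Entn_triple n : Entn triple_weight triple_word n = Entn u x (3 * n).
Proof. by rewrite /Entn step_triple; congr Ent; apply/funext => f; rewrite -iterM mulnC. Qed.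

End Triple.

Section PositiveEntropy.
Variables (R : realType) (G : groupType) (mu : G -> R).
Local Open Scope ring_scope.
Hypotheses (mu_prob : is_probability mu) (mu_ent : finite_entropy mu).

Let mu0 g : 0 <= mu g. Proof. exact: mu_prob.1. Qed.

Let mu1 g : mu g <= 1.
Proof.
have := fmass_le1 mu_prob [fset g]%fset.
by rewrite /fmass big_seq_fset1.
Qed.

Let P (B : {fset G}) := step (@truncw R G mu B) (@truncx G B).

Let phi (g : G) : R := - (mu g * ln (mu g)).

Let phi_ge0 g : 0 <= phi g.
Proof. by rewrite /phi oppr_ge0 mulr_ge0_le0 // ln_le0. Qed.

Let phi_tail e : 0 < e -> exists2 E : {fset G}, in_supp mu E &
  forall B : {fset G}, (E `<=` B)%fset ->
    \sum_(b <- B | b \notin E) (phi b + mu b) <= e.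
Proof.
move=> e0; have e20 : 0 < e / 2 by rewrite divr_gt0.
have : exists H : R, \esum_(g in [set: G]) (phi g)%:E = H%:E.
  exists (fine (entropy mu)); rewrite fineK //.
  by rewrite ge0_fin_numE //; apply: esum_ge0 => g _; rewrite lee_fin phi_ge0.
case=> H /(esum_fsetsP phi)[leH /(_ _ e20)[E1 hE1]].
have [E2 hE2] := fmass_gt mu_prob e20.
pose E := [fset b in E1 `|` E2 | (0 < mu b)%R]%fset.
have sumE (a : G -> R) : (forall b, mu b = 0 -> a b = 0) ->
    \sum_(b <- E) a b = \sum_(b <- (E1 `|` E2)%fset) a b.
  by move=> a0; rewrite (restrict_supp mu_prob).
exists E; first by apply/in_suppP => b; rewrite !inE => /andP[].
move=> B EB.
have tailE (a : G -> R) :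
    \sum_(b <- B | b \notin E) a b = \sum_(b <- B) a b - \sum_(b <- E) a b.
  by apply/eqP; rewrite eq_sym subr_eq addrC (bigID (mem E)) /= sum_fset_mem.
rewrite big_split /= !tailE !sumE //; last by move=> b mb; rewrite /phi mb mul0r oppr0.
have := sum_fset_subset phi_ge0 (fsubsetUl E1 E2).
have := sum_fset_subset mu0 (fsubsetUr E1 E2).
have := fmass_le1 mu_prob B; have := leH B; rewrite /fmass in hE2 *; lra.
Qed.

(** The form taken by the absence of nonconstant bounded harmonic functions after [exists_harmonic]:
    one time serves all large truncations and all test functions. *)
Hypothesis liouville : forall g eps, 0 < eps -> exists n, exists2 B0 : {fset G}, in_supp mu B0 &
  forall B, (B0 `<=` B)%fset -> in_supp mu B -> forall f, (forall y, 0 <= f y <= 1) ->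
    iter n (P B) f g - iter n (P B) f 1%g < eps.

Let in_suppU B C : in_supp mu B -> in_supp mu C -> in_supp mu (B `|` C)%fset.
Proof.
move=> /in_suppP sB /in_suppP sC; apply/in_suppP => b.
by rewrite inE => /orP[/sB|/sC].
Qed.

Let close_seq (s : seq G) eps : 0 < eps -> exists n0, exists2 B0 : {fset G}, in_supp mu B0 &
  forall B, (B0 `<=` B)%fset -> in_supp mu B -> forall n f, (n0 <= n)%N ->
    (forall y, 0 <= f y <= 1) ->
    {in s, forall g, iter n (P B) f g - iter n (P B) f 1%g < eps}.
Proof.
move=> eps0; elim: s => [|g s [n1 [B1 sB1 H1]]].
  by exists 0%N, fset0 => //; apply/in_suppP => b; rewrite inE.
have [n2 [B2 sB2 H2]] := liouville g eps0.
exists (maxn n1 n2), (B1 `|` B2)%fset => [|B]; first exact: in_suppU.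
rewrite fsubUset => /andP[B1B B2B] sB n f; rewrite geq_max => /andP[n1n n2n] f01 h.
rewrite inE => /predU1P[->|hs]; last exact: H1.
(* Closeness at time [n2] persists later: the remaining steps replace [f] by one of its iterates,
   again with values in [0, 1]. *)
rewrite -(subnKC n2n) !iterD; apply: H2 => // y.
by apply: iter_step01 => // [t|]; [exact: truncw_ge0|exact: sum_truncw1].
Qed.

Let phi_half g : 0 < mu g -> - (mu g / 2 * ln (mu g / 2)) <= phi g + mu g.
Proof.
move=> m0; rewrite ln_div ?posrE // /phi.
have : ln 2 <= 1 :> R.
  by have := @le_ln1Dx R 1; rewrite -(natrD _ 1 1); apply; lra.
have : mu g * ln (mu g) <= 0 by rewrite mulr_ge0_le0 // ln_le0.
have := mu0 g; nra.
Qed.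

(** Letters in a finite set [E], and the unit, are handled by closeness of laws; any other letter
    contributes at most its own entropy term, and these terms sum to a small tail. *)
Let Ent_increment (e : R) : 0 < e -> exists n0, exists2 B0 : {fset G}, in_supp mu B0 &
  forall B, (B0 `<=` B)%fset -> in_supp mu B -> forall n, (n0 <= n)%N ->
    Entn (@truncw R G mu B) (@truncx G B) n.+1 - Entn (@truncw R G mu B) (@truncx G B) n <= e.
Proof.
move=> e0; have e20 : 0 < e / 2 by rewrite divr_gt0.
have [E sE tail] := phi_tail e20.
(* The [#|E| + 1] letters, unit included, cost [2 * eps] each and use up half of [e]; the tail takes
   the other half. *)
pose eps := e / (4 * (#|` E|.+1)%:R).
have eps0 : 0 < eps by rewrite divr_gt0 // mulr_gt0 // ltr0n.
have [n1 [B1 sB1 H1]] := close_seq (1%g :: E) eps0.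
have [n2 H2] := invsqrt_small eps0.
exists (maxn n1 n2), (B1 `|` E)%fset => [|B]; first exact: in_suppU.
rewrite fsubUset => /andP[B1B EB] sB n; rewrite geq_max => /andP[n1n n2n].
have u0 o : 0 < @truncw R G mu B o by exact: truncw_gt0.
have u1 := sum_truncw1 mu B.
rewrite EntnS //.
pose bd (o : option B) : R := if o is Some b then
  (if val b \in E then 2 * eps else 0) + (if val b \notin E then phi (val b) + mu (val b) else 0)
  else 2 * eps.
apply: (@le_trans _ _ (\sum_o bd o)).
  apply: ler_sum => o _.
  have fine : @truncx G B o \in 1%g :: E -> @truncw R G mu B o * Ex (@truncw R G mu B) n
      (fun l => ln (mass (@truncw R G mu B) (@truncx G B) n (word (@truncx G B) l) /
        mass (@truncw R G mu B) (@truncx G B) n.+1 (@truncx G B o * word (@truncx G B) l)%g))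
      <= 2 * eps.
    move=> oE; apply: Ent_step_fine => // f f01.
    have := H1 B B1B sB n f n1n f01 _ oE.
    have := iter_trunc_dist_le mu_prob B n 1%g f01.
    by rewrite ler_norml => /andP[]; have := H2 n n2n; rewrite -/(P B); lra.
  case: o fine => [b|] fine /=; last by apply: fine; rewrite inE eqxx.
  case: ifP => bE /=; first by rewrite addr0; apply: fine; rewrite inE /= bE orbT.
  rewrite add0r; apply: le_trans (phi_half _); last by move/in_suppP: sB; apply; exact: valP.
  rewrite -mulrN ler_pM2l; last exact: (u0 (Some b)).
  exact: (Ent_step_crude (@truncx G B) u0 u1 n (Some b)).
rewrite big_option /= big_split /=.
rewrite -(big_seq_fsetE _ B xpredT (fun b => if b \in E then 2 * eps else 0)).
rewrite -(big_seq_fsetE _ B xpredT (fun b => if b \notin E then phi b + mu b else 0)).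
rewrite -!big_mkcond /= (sum_fset_mem (fun=> 2 * eps) EB).
have := tail B EB; rewrite big_const_seq count_predT iter_addr addr0 -[_ *+ _]mulr_natl.
have : #|` E|.+1%:R * eps = e / 4.
  have : #|` E|.+1%:R != 0 :> R by rewrite pnatr_eq0.
  by rewrite /eps; move: (_.+1%:R) => x x0; field.
rewrite -natr1; lra.
Qed.

Section Contradiction.
Variables (Z : zmodType) (A : comPzRingType) (K : G -> Z) (chi : Z -> A) (up : G -> A).
Hypothesis KM : forall g h, K (g * h)%g = K g + K h.
Hypothesis upM : forall g h, up (g * h)%g = up g * chi (K h) + up h.
Variables (a b a1 a2 a3 : G).
Hypotheses (mua : 0 < mu a) (mub : 0 < mu b).
Hypotheses (mua1 : 0 < mu a1) (mua2 : 0 < mu a2) (mua3 : 0 < mu a3).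
Hypothesis free_v : injective (fun n : nat * nat * nat =>
  K a1 *+ n.1.1 + K a2 *+ n.1.2 + K a3 *+ n.2).
Variables (C : finType) (cl : Z -> C).
Hypothesis sep : forall r : seq Z, uniq r -> forall kappa, {in r, forall k, cl k = kappa} ->
  forall c c' : Z -> bool,
  \sum_(k <- r) ((up (a * b)%g - up (b * a)%g) * chi k) *+ c k =
  \sum_(k <- r) ((up (a * b)%g - up (b * a)%g) * chi k) *+ c' k ->
  {in r, c =1 c'}.

Let K1 : K 1%g = 0.
Proof. by apply: (addIr (K 1%g)); rewrite -KM mul1g add0r. Qed.

Let m := Num.min (mu a) (Num.min (mu b) (Num.min (mu a1) (Num.min (mu a2) (mu a3)))).

Let m_gt0 : 0 < m.
Proof. by rewrite !lt_min mua mub mua1 mua2. Qed.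

Let m_le : [/\ m <= mu a, m <= mu b, m <= mu a1, m <= mu a2 & m <= mu a3].
Proof. by split; rewrite !ge_min lexx ?orbT. Qed.

(** A lower bound for the weight of every triple made of the five letters and the unit, valid in all
    truncations containing them. *)
Let c := (m / 2) ^+ 3.

Let c_gt0 : 0 < c. Proof. by rewrite exprn_gt0 // divr_gt0. Qed.

Lemma Ent_growth B : in_supp mu B -> [&& a \in B, b \in B, a1 \in B, a2 \in B & a3 \in B] ->
  forall n, ln 2 * c / 12 * n%:R <= #|C|%:R * Entn (@truncw R G mu B) (@truncx G B) (3 * n).
Proof.
move=> sB /and5P[aB bB a1B a2B a3B] n.
pose w := @truncw R G mu B; pose x := @truncx G B.
have w_gt0 o : 0 < w o by exact: truncw_gt0.
have w1 : \sum_o w o = 1 by exact: sum_truncw1.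
have [ma mb ma1 ma2 ma3] := m_le.
have wN : m / 2 <= w None by have := truncw_lazy mu_prob B; have := mu1 a; rewrite -/w; lra.
have wS g (gB : g \in B) : m <= mu g -> m / 2 <= w (Some [` gB]%fset).
  by move=> mg; rewrite /w /= ler_pM2r // invr_gt0.
pose D (e : bool) := if e then (Some [` aB]%fset, Some [` bB]%fset, None : option B)
                     else (Some [` bB]%fset, Some [` aB]%fset, None : option B).
pose M (e : bool * bool * bool) := (if e.1.1 then Some [` a1B]%fset else None : option B,
  if e.1.2 then Some [` a2B]%fset else None : option B,
  if e.2 then Some [` a3B]%fset else None : option B).
have w3_ge t : m / 2 <= w t.1.1 -> m / 2 <= w t.1.2 -> m / 2 <= w t.2 -> c <= triple_weight w t.
  have h0 : 0 <= m / 2 by rewrite divr_ge0 // ltW.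
  move=> h1 h2 h3; rewrite /c exprSr expr2 /triple_weight.
  by apply: ler_pM => //; [rewrite mulr_ge0|apply: ler_pM].
have wD e : c <= triple_weight w (D e) by case: e; apply: w3_ge => //=; exact: wS.
have wM e : c <= triple_weight w (M e).
  by case: e => [[[] []] []]; apply: w3_ge => //=; exact: wS.
have w3_gt0 t : 0 < triple_weight w t by rewrite !mulr_gt0.
have w31 := sum_triple_weight w1.
have kM e : K (triple_word x (M e)) = K a1 *+ e.1.1 + K a2 *+ e.1.2 + K a3 *+ e.2.
  by rewrite /triple_word !KM; case: e => [[[] []] []] /=; rewrite ?K1.
have green := @green_le _ _ _ _ (fun t => K (triple_word x t)) (fun t => ltW (w3_gt0 t)) w31
  _ _ _ free_v M kM c c_gt0 wM.
have KD : K (triple_word x (D false)) = K (triple_word x (D true)).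
  by rewrite /triple_word /= !KM (addrC (K b)).
have xT : triple_word x (D true) = (a * b)%g by rewrite /triple_word /= mulg1.
have xF : triple_word x (D false) = (b * a)%g by rewrite /triple_word /= mulg1.
(* The value [c / 6] makes [s * Gamma] equal to 1/2 for the bound [3 / c] of [green_le], so the
   range grows at rate at least [c / 12]. *)
have s_gt0 : 0 < c / 6 by rewrite divr_gt0.
have sD e : c / 6 < triple_weight w (D e) by apply: lt_le_trans (wD e); lra.
have sep' : forall r : seq Z, uniq r -> forall kappa, {in r, forall k, cl k = kappa} ->
  forall d d' : Z -> bool,
  \sum_(k <- r) ((up (triple_word x (D true)) - up (triple_word x (D false))) * chi k) *+ d k =
  \sum_(k <- r) ((up (triple_word x (D true)) - up (triple_word x (D false))) * chi k) *+ d' k ->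
  {in r, d =1 d'} by rewrite xT xF.
have := Entn_switch_ge KM upM w3_gt0 w31 s_gt0 sD KD sep' green n.
rewrite Entn_triple; have -> : c / 6 * (3 / c) = 1 / 2 by field; rewrite gt_eqF.
by apply: le_trans; rewrite le_eqVlt; apply/orP; left; apply/eqP; field.
Qed.

Lemma liouville_absurd : False.
Proof.
have C0 : 0 < #|C|%:R :> R by rewrite ltr0n; apply/card_gt0P; exists (cl 0).
have ln2 : 0 < ln 2 :> R by rewrite ln_gt0 // ltr1n.
pose kappa := ln 2 * c / 12.
have kappa0 : 0 < kappa by rewrite divr_gt0 // mulr_gt0.
pose d := kappa / #|C|%:R.
have d0 : 0 < d by rewrite divr_gt0.
(* Three steps with increments at most [d / 6] give [d / 2] per unit of n, half of the lower rate
   [d]. *)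
have d60 : 0 < d / 6 by rewrite divr_gt0.
have [n0 [B0 sB0 H]] := Ent_increment d60.
pose B := (B0 `|` [fset a; b; a1; a2; a3])%fset.
have sB : in_supp mu B.
  apply: in_suppU => //; apply/in_suppP => g.
  by rewrite !inE -!orbA => /or4P[| | |/orP[]] /eqP->.
have allB : [&& a \in B, b \in B, a1 \in B, a2 \in B & a3 \in B].
  by rewrite !inE !eqxx ?orbT.
have {H} inc := H B (fsubsetUl _ _) sB.
set E := Entn _ _ in inc.
have upper k : E (n0 + k)%N <= E n0 + k%:R * (d / 6).
  elim: k => [|k IH]; first by rewrite addn0 mul0r addr0.
  rewrite addnS -natr1 mulrDl mul1r addrA; apply: le_trans (lerD IH (lexx (d / 6))).
  by rewrite -lerBlDl inc ?leq_addr.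
have lower n : d * n%:R <= E (3 * n)%N.
  rewrite /d mulrAC ler_pdivrMr // [leRHS]mulrC; exact: Ent_growth.
clearbody d E.
have key n : (n0 <= n)%N -> d / 2 * n%:R <= E n0.
  move=> n0n; have n3 : (n0 <= 3 * n)%N by rewrite (leq_trans n0n) ?leq_pmull.
  have := upper (3 * n - n0)%N; rewrite subnKC // natrB // natrM mulrBl.
  have := lower n; have : 0 <= n0%:R * (d / 6) by rewrite mulr_ge0 // ltW.
  lra.
pose n := (n0 + (Num.truncn (E n0 / (d / 2))).+1)%N.
have := key n (leq_addr _ _); rewrite leNgt => /negP; apply.
rewrite mulrC -ltr_pdivrMr ?divr_gt0 //.
apply: lt_le_trans (real_truncnS_gt (num_real _)) _.
by rewrite ler_nat leq_addl.
Qed.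

End Contradiction.

End PositiveEntropy.

Section HarmonicExistence.
Variables (R : realType) (G : groupType) (mu : G -> R).
Variables (Z : zmodType) (A : comPzRingType) (K : G -> Z) (chi : Z -> A) (up : G -> A).
Variables (C : finType) (cl : Z -> C).
Local Open Scope ring_scope.

Lemma exists_bounded_harmonic (a b a1 a2 a3 : G) :
  is_probability mu -> finite_entropy mu ->
  (forall g h, K (g * h)%g = K g + K h) ->
  (forall g h, up (g * h)%g = up g * chi (K h) + up h) ->
  0 < mu a -> 0 < mu b -> 0 < mu a1 -> 0 < mu a2 -> 0 < mu a3 ->
  injective (fun n : nat * nat * nat => K a1 *+ n.1.1 + K a2 *+ n.1.2 + K a3 *+ n.2) ->
  (forall r : seq Z, uniq r -> forall kappa, {in r, forall k, cl k = kappa} ->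
    forall c c' : Z -> bool,
    \sum_(k <- r) ((up (a * b)%g - up (b * a)%g) * chi k) *+ c k =
    \sum_(k <- r) ((up (a * b)%g - up (b * a)%g) * chi k) *+ c' k ->
    {in r, c =1 c'}) ->
  exists F : G -> R, [/\ forall y, 0 <= F y <= 1, forall y, harmonic_at mu F y &
    exists g, F g <> F 1%g].
Proof.
move=> mu_prob mu_ent KM upM mua mub mua1 mua2 mua3 free_v sep.
apply: contrapT => noF.
apply: (liouville_absurd mu_prob mu_ent _ KM upM mua mub mua1 mua2 mua3 free_v sep).
move=> g eps eps0; apply: contrapT => far; apply: noF.
have [] := @exists_harmonic R G mu mu_prob g eps eps0; last first.
  by move=> F [F01 hF Fg]; exists F; split=> //; exists g.
move=> n B0 sB0; apply: contrapT => noB; apply: far; exists n, B0 => // B B0B sB f f01.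
by rewrite ltNge; apply/negP => h; apply: noB; exists B; split=> //; exists f.
Qed.

End HarmonicExistence.

(** * Small coefficients and substitution of powers *)

HB.lock Definition lsubst d N (u : laurent d) : laurent d := lpowvars N u.

Section LaurentSubstitution.
Variable d : nat.
Local Open Scope ring_scope.
Implicit Types (u v w : laurent d) (k l m : 'rV[int]_d) (N M : nat).

Lemma laurent_elim (Q : laurent d -> Prop) :
  Q 0 -> (forall u v, Q u -> Q v -> Q (u + v)) ->
  (forall c k, Q (lmono c k)) -> forall u, Q u.
Proof. exact: laurent_ind. Qed.

Lemma lmonoM c c' k k' : lmono c k * lmono c' k' = lmono (c * c') (k + k') :> laurent d.
Proof. exact: lmulUU. Qed.

Lemma lcoeff0 m : monalg.mcoeff m (0 : laurent d) = 0.
Proof. exact: monalg.mcoeff0. Qed.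

Lemma lcoeffD m u v : monalg.mcoeff m (u + v) = monalg.mcoeff m u + monalg.mcoeff m v.
Proof. exact: monalg.mcoeffD. Qed.

Lemma lcoeffN m u : monalg.mcoeff m (- u) = - monalg.mcoeff m u.
Proof. exact: monalg.mcoeffN. Qed.

Lemma lcoeff_sum m (I : Type) (r : seq I) (F : I -> laurent d) :
  monalg.mcoeff m (\sum_(i <- r) F i) = \sum_(i <- r) monalg.mcoeff m (F i).
Proof.
by apply: (big_morph (monalg.mcoeff m)) => [u v|]; [exact: lcoeffD|exact: lcoeff0].
Qed.

Lemma mcoeff_lmono c k m : monalg.mcoeff m (lmono c k) = if k == m then c else 0.
Proof. by rewrite /lmono mcoeffU; case: eqP; rewrite ?mulr1n ?mulr0n. Qed.

Lemma mcoeff_lmonoM c k w m :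
  monalg.mcoeff m (lmono c k * w) = c * monalg.mcoeff (m - k) w.
Proof.
move: w; apply: laurent_elim => [|u v IHu IHv|c' l].
- by rewrite mulr0 !lcoeff0 mulr0.
- by rewrite mulrDr !lcoeffD IHu IHv mulrDr.
rewrite lmonoM !mcoeff_lmono.
have -> : (k + l == m) = (l == m - k) by rewrite addrC eq_sym -subr_eq eq_sym.
by case: eqP => _; rewrite ?mulr0.
Qed.

Lemma mcoeffM u w m : monalg.mcoeff m (u * w) =
  \sum_(k <- monalg.msupp u) monalg.mcoeff k u * monalg.mcoeff (m - k) w.
Proof.
rewrite {1}(laurentE u) mulr_suml lcoeff_sum.
by apply: eq_bigr => k _; rewrite mcoeff_lmonoM.
Qed.

Lemma lsubstw (D : {fset 'rV[int]_d}) N u : (monalg.msupp u `<=` D)%fset ->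
  lsubst N u = \sum_(k <- D) lmono (monalg.mcoeff k u) (k *+ N).
Proof.
move=> uD; rewrite lsubst.unlock /lpowvars (big_fset_incl _ uD) // => k _ /mcoeff_outdom ->.
by rewrite lmono0.
Qed.

Lemma lsubstD N u v : lsubst N (u + v) = lsubst N u + lsubst N v.
Proof.
rewrite (lsubstw N (monalg.msuppD_le u v)).
rewrite (lsubstw N (fsubsetUl _ (monalg.msupp v))).
rewrite (lsubstw N (fsubsetUr (monalg.msupp u) _)) -big_split.
by apply: eq_bigr => k _; rewrite lcoeffD lmonoD.
Qed.

Lemma lsubst0 N : lsubst N 0 = 0 :> laurent d.
Proof. by apply: (addrI (lsubst N 0)); rewrite -lsubstD !addr0. Qed.

Lemma lsubstN N u : lsubst N (- u) = - lsubst N u.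
Proof. by apply: (addrI (lsubst N u)); rewrite -lsubstD !subrr lsubst0. Qed.

Lemma lsubst_lmono N c k : lsubst N (lmono c k) = lmono c (k *+ N).
Proof. by rewrite (lsubstw N msuppU_le) big_seq_fset1 mcoeff_lmono eqxx. Qed.

Lemma lsubstM N u v : lsubst N (u * v) = lsubst N u * lsubst N v.
Proof.
move: u; apply: laurent_elim => [|u1 u2 IH1 IH2|c k].
- by rewrite mul0r lsubst0 mul0r.
- by rewrite mulrDl !lsubstD mulrDl IH1 IH2.
move: v; apply: laurent_elim => [|v1 v2 IH1 IH2|c' k'].
- by rewrite mulr0 lsubst0 mulr0.
- by rewrite mulrDr !lsubstD mulrDr IH1 IH2.
by rewrite lmonoM [LHS]lsubst_lmono mulrnDl -[LHS]lmonoM; congr (_ * _); rewrite lsubst_lmono.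
Qed.

Lemma lsubst_comp N M u : lsubst N (lsubst M u) = lsubst (M * N) u.
Proof.
move: u; apply: laurent_elim => [|u v IHu IHv|c k].
- by rewrite !lsubst0.
- by rewrite (lsubstD M u v) (lsubstD N) (lsubstD (M * N) u v) IHu IHv.
by rewrite !lsubst_lmono mulrnA.
Qed.

Lemma mcoeff_lsubst N u l : (0 < N)%N ->
  monalg.mcoeff (l *+ N) (lsubst N u) = monalg.mcoeff l u.
Proof.
move=> N0; move: u; apply: laurent_elim => [|u v IHu IHv|c k].
- by rewrite lsubst0 !lcoeff0.
- by rewrite (lsubstD N u v) !lcoeffD IHu IHv.
rewrite lsubst_lmono !mcoeff_lmono; congr (if _ then _ else _).
apply/eqP/eqP => [|->//] /matrixP kl; apply/matrixP => i j.
by have := kl i j; rewrite !mulmxnE; apply: pmulrnI.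
Qed.

Lemma mcoeff_lsubst0 N u m : (forall l, m <> l *+ N) ->
  monalg.mcoeff m (lsubst N u) = 0.
Proof.
move=> mN; move: u; apply: laurent_elim => [|u v IHu IHv|c k].
- by rewrite lsubst0 !lcoeff0.
- by rewrite (lsubstD N u v) lcoeffD IHu IHv addr0.
by rewrite lsubst_lmono mcoeff_lmono; case: eqP => // /esym /mN.
Qed.

Definition small_coeffs u : Prop := forall k, monalg.mcoeff k u \in [:: 0; 1; -1].

(** Exceeds the absolute value of every coordinate of a difference of two exponents of [u]. *)
Definition spread u : nat :=
  (\sum_(k <- monalg.msupp u) \sum_i `|k 0%R i|).*2.+1.

Lemma spread_inj u k k' l : k \in monalg.msupp u -> k' \in monalg.msupp u ->
  k - k' = l *+ spread u -> k = k'.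
Proof.
have le h i : h \in monalg.msupp u ->
    (`|h 0%R i| <= \sum_(k <- monalg.msupp u) \sum_i `|k 0%R i|)%N.
  move=> hu; rewrite (big_fsetD1 h) //= (bigD1 i) //= -addnA; exact: leq_addr.
move=> ku k'u kl; apply/matrixP => i j; rewrite !ord1.
have := congr1 (fun v : 'rV[int]_d => v 0 j) kl; rewrite mulmxnE !mxE /spread.
have := le k j ku; have := le k' j k'u.
move: (\sum_(_ <- _) _)%N (k 0 j) (k' 0 j) (l 0 j) => S x y z; rewrite -mulr_natr natz => xS yS e.
have [z0|[z1|z1]] : z = 0 \/ 1 <= z \/ z <= -1 by lia.
- by move: e; rewrite z0; lia.
- by have : S.*2.+1%:Z <= z * S.*2.+1%:Z; [rewrite ler_peMl|rewrite -e; lia].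
- have : S.*2.+1%:Z <= - z * S.*2.+1%:Z by rewrite ler_peMl //; lia.
  by rewrite mulNr -e; lia.
Qed.

(* By [spread_inj], distinct products of a term of [u] by a term of the second  *)
(* factor have distinct exponents.                                              *)
Lemma spread_mul u v : small_coeffs u -> u != 0 -> small_coeffs v -> v != 0 ->
  small_coeffs (u * lsubst (spread u) v) /\ u * lsubst (spread u) v != 0.
Proof.
move=> su u0 sv v0; have N0 : (0 < spread u)%N by [].
have coeff1 k l : k \in monalg.msupp u ->
    monalg.mcoeff (k + l *+ spread u) (u * lsubst (spread u) v) =
    monalg.mcoeff k u * monalg.mcoeff l v.
  move=> ku; rewrite mcoeffM (big_fsetD1 k) //= addrAC subrr add0r mcoeff_lsubst //.
  rewrite big1_fset ?addr0 // => k'; rewrite !inE => /andP[k'k k'u] _.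
  rewrite mcoeff_lsubst0 ?mulr0 // => l' e; case/eqP: k'k.
  apply: (@spread_inj u _ _ (l - l')) => //.
  rewrite mulrnBl -e; move: (l *+ _) => x; apply/matrixP => i j; rewrite !mxE; ring.
split=> [m|].
  have [[k [l [ku ->]]]|no] := pselect (exists k l, k \in monalg.msupp u /\ m = k + l *+ spread u).
    rewrite coeff1 //; move: (su k) (sv l); rewrite !inE.
    by move=> /or3P[] /eqP-> /or3P[] /eqP->.
  rewrite mcoeffM big1_fset // => k ku _; rewrite mcoeff_lsubst0 ?mulr0 // => l e.
  by apply: no; exists k, l; split=> //; rewrite -e addrC subrK.
have supp_ex w : w != 0 -> exists k, k \in monalg.msupp w.
  by have [e|[k kw]] := fset_0Vmem (monalg.msupp w);
    [rewrite (laurentE w) e big_seq_fset0 eqxx|exists k].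
have [k ku] := supp_ex u u0; have [l lv] := supp_ex v v0.
apply/eqP => uv0; have := coeff1 k l ku; rewrite uv0 lcoeff0 => /esym/eqP.
by rewrite mulf_eq0 => /orP[]; apply/negP; rewrite monalg.mcoeff_neq0.
Qed.

End LaurentSubstitution.

(** * Spaced torsion *)

Section Annihilated.
Variables (d : nat) (p : laurent d).
Local Open Scope ring_scope.
Implicit Types (u v w : laurent d) (y z : lquot p) (k l : 'rV[int]_d).

Local Notation pr := (lproj p).

Lemma prM u v : pr (u * v) = pr u * pr v.
Proof. by rewrite -[LHS]lprojM. Qed.

Lemma prD u v : pr (u + v) = pr u + pr v.
Proof. by rewrite lprojD. Qed.

Lemma pr0 : pr 0 = 0.
Proof. by apply: (addrI (pr 0)); rewrite -prD !addr0. Qed.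

Lemma prN u : pr (- u) = - pr u.
Proof. by apply: (addrI (pr u)); rewrite -prD !subrr pr0. Qed.

Lemma pr_eq0 u : pr u = 0 -> ldvd p u.
Proof. by rewrite -pr0 => /lprojP; rewrite subr0 => /lidealP. Qed.

Definition chi k : lquot p := pr (lmono 1 k).

Lemma chiD k l : chi (k + l) = chi k * chi l.
Proof. by rewrite /chi -prM lmonoM mulr1. Qed.

Lemma chi0 : chi 0 = 1. Proof. by []. Qed.

Lemma chiNK k : chi (- k) * chi k = 1.
Proof. by rewrite -chiD addNr. Qed.

(* [z] is killed by small-coefficient polynomials in arbitrarily high powers of *)
(* the variables.                                                              *)
Definition spaced_torsion z : Prop := forall N, (0 < N)%N ->
  exists u, [/\ u != 0, small_coeffs u & pr (lsubst N u) * z = 0].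

Lemma spaced_torsion0 : spaced_torsion 0.
Proof.
move=> N _; exists (lmono 1 0); rewrite mulr0; split=> //; first exact: lmono1_neq0.
by move=> k; rewrite mcoeff_lmono; case: eqP.
Qed.

Lemma spaced_torsionM y z : spaced_torsion z -> spaced_torsion (y * z).
Proof.
by move=> tz N /tz[u [u0 su uz]]; exists u; split=> //; rewrite mulrCA uz mulr0.
Qed.

(** If [u] kills [y] at spacing [N], let [v] kill [z] at spacing [spread u * N]; by [spread_mul]
    their product, with [v] spread out, is small and nonzero, and at spacing [N] it kills both. *)
Lemma spaced_torsionD y z :
  spaced_torsion y -> spaced_torsion z -> spaced_torsion (y + z).
Proof.
move=> ty tz N N0; have [u [u0 su uy]] := ty N N0.
have [|v [v0 sv vz]] := tz (spread u * N)%N; first by rewrite muln_gt0.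
have [sw w0] := spread_mul su u0 sv v0.
exists (u * lsubst (spread u) v); split=> //; rewrite lsubstM lsubst_comp prM mulrDr.
by rewrite mulrAC uy mul0r add0r -mulrA vz mulr0.
Qed.

Lemma spaced_torsionN z : spaced_torsion z -> spaced_torsion (- z).
Proof. by move=> tz; rewrite -mulN1r; apply: spaced_torsionM. Qed.

Hypothesis spaced : spaced_polynomial_property p.

(** If u(x^N) killed x^k - 1, it would kill its multiple x^(ksN) - 1 with s the spread of u. The
    product of u and x^(ks) - 1 is small and nonzero, and [p] would divide its substitution. *)
Lemma spaced_not_torsion k : k != 0 -> ~ spaced_torsion (chi k - 1).
Proof.
case: spaced => N [N0 nodvd] k0 /(_ N N0)[u [u0 su uk]].
pose v : laurent d := lmono 1 k - lmono 1 0.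
have sv : small_coeffs v.
  move=> l; rewrite lcoeffD lcoeffN !mcoeff_lmono; case: eqP => [<-|_]; last by case: eqP.
  by rewrite eq_sym (negPf k0).
have v0 : v != 0.
  apply/eqP => v0; have := lcoeff0 k; rewrite -v0 lcoeffD lcoeffN !mcoeff_lmono eqxx eq_sym.
  by rewrite (negPf k0).
have [sw w0] := spread_mul su u0 sv v0.
apply: (nodvd _ w0 sw); apply: pr_eq0.
have chiX n : chi (k *+ n) = chi k ^+ n.
  by elim: n => [|n IH]; rewrite ?mulr0n ?chi0 // mulrSr exprSr chiD IH.
have -> : lpowvars N (u * lsubst (spread u) v) = lsubst N (u * lsubst (spread u) v).
  by rewrite lsubst.unlock.
rewrite lsubstM lsubst_comp prM lsubstD lsubstN !lsubst_lmono mul0rn prD prN.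
have -> : pr (lmono 1 (k *+ (spread u * N))) - pr (lmono 1 0) = chi k ^+ (spread u * N) - 1.
  by rewrite -chiX.
by rewrite subrX1 mulrA uk mul0r.
Qed.

(** Makes the exponent of a group element well defined, hence [K] additive. *)
Lemma chi_inj : injective chi.
Proof.
move=> k l kl; apply/eqP; rewrite -subr_eq0; apply/negPn/negP => kl0.
apply: (spaced_not_torsion kl0).
have -> : chi (k - l) - 1 = 0; last exact: spaced_torsion0.
by rewrite chiD kl mulrC chiNK subrr.
Qed.

End Annihilated.

(** * Coordinates on the group *)

Lemma generated_elim (G : groupType) (S H : set G) :
  generated S = [set: G]%classic -> is_subgroup H -> (S `<=` H)%classic -> forall g, H g.
Proof.
move=> genS sH SH g; have : generated S g by rewrite genS.
by apply; split.
Qed.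

Section UpperTriangularGroup.
Variable A : comPzRingType.
Local Open Scope ring_scope.
Implicit Types (a b c f h : A).

Lemma ut_inj a b c a' b' c' : ut a b c = ut a' b' c' -> [/\ a = a', b = b' & c = c'].
Proof.
move=> /matrixP E; split.
- by have := E 0 0; rewrite !mxE.
- by have := E 0 1; rewrite !mxE.
- by have := E 1 1; rewrite !mxE.
Qed.

Lemma ut1M f c h c' : ut 1 f c * ut 1 h c' = ut 1 (f * c' + h) (c * c').
Proof. by rewrite utM !mul1r addrC. Qed.

Lemma unit_inv_ut (x : ring_units 'M[A]_2) f c c' : c * c' = 1 ->
  unit_val x = ut 1 f c -> unit_inv x = ut 1 (- (f * c')) c'.
Proof.
move=> cc' xE.
have e : unit_val x * ut 1 (- (f * c')) c' = 1 by rewrite xE ut1M subrr cc' ut1.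
by rewrite -[LHS]mulr1 -e mulrA unit_invV mul1r.
Qed.

Lemma affine_comm f c h c' :
  f * c' + h - (h * c + f) = f * (c' - 1) - h * (c - 1).
Proof. by rewrite !mulrBr !mulr1 !opprD opprK addrACA (addrC (f * c')) addrACA addrC addrACA. Qed.

Lemma affine_commM f c h c' g b :
  (f * c' + h) * (b - 1) - g * (c * c' - 1) =
  c' * (f * (b - 1) - g * (c - 1)) + (h * (b - 1) - g * (c' - 1)).
Proof. ring. Qed.

End UpperTriangularGroup.

Section PolynomialGroup.
Variables (d : nat) (p : laurent d).
Local Open Scope ring_scope.
Local Open Scope classical_set_scope.
Hypothesis spaced : spaced_polynomial_property p.

Local Notation A := (lquot p).
Local Notation chi := (@chi d p).
Local Notation G := (Gpoly p).

Definition gmat (g : G) : 'M[A]_2 := unit_val (val g).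

Lemma gmatM g h : gmat (g * h)%g = gmat g * gmat h.
Proof. by []. Qed.

Lemma gmat_form g : exists k f, gmat g = ut 1 f (chi k).
Proof.
pose Q (x : ring_units 'M[A]_2) := exists k f, unit_val x = ut 1 f (chi k).
suff : Q (val g) by [].
have : generated ([set delta_gen p] `|` range (@M_gen d p)) (val g).
  exact: set_mem (valP g).
apply; split.
  split; first by exists 0, 0; rewrite chi0 ut1.
  move=> x y [k [f xE]] [l [h yE]].
  have ll : chi l * chi (- l) = 1 by rewrite mulrC chiNK.
  exists (k - l), (f * chi (- l) - h * chi (- l)); rewrite chiD -ut1M -xE.
  by rewrite -(unit_inv_ut ll yE).
move=> x [->|[i _ <-]]; first by exists 0, 1; rewrite chi0.
by exists (delta_mx 0 i), 0.
Qed.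

Lemma gmat_coords : exists K : G -> 'rV[int]_d, exists up : G -> A,
  forall g, gmat g = ut 1 (up g) (chi (K g)).
Proof.
have [K HK] := choice gmat_form; have [up Hup] := choice HK.
by exists K, up.
Qed.

Section Coordinates.
Variables (K : G -> 'rV[int]_d) (up : G -> A).
Hypothesis coords : forall g, gmat g = ut 1 (up g) (chi (K g)).

Let KupM g h : K (g * h)%g = K g + K h /\ up (g * h)%g = up g * chi (K h) + up h.
Proof.
have := gmatM g h; rewrite !coords ut1M -chiD => /ut_inj[_ -> KE].
by rewrite (chi_inj spaced KE).
Qed.

Lemma KM g h : K (g * h)%g = K g + K h. Proof. by case: (KupM g h). Qed.
Lemma upM g h : up (g * h)%g = up g * chi (K h) + up h. Proof. by case: (KupM g h). Qed.

(** As [g h] and [h g] have the same exponent, this ring element is the whole obstruction to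
    commuting. *)
Definition comm g h : A := up (g * h)%g - up (h * g)%g.

Lemma commE g h : comm g h = up g * (chi (K h) - 1) - up h * (chi (K g) - 1).
Proof. by rewrite /comm !upM; exact: affine_comm. Qed.

Lemma commC g h : comm h g = - comm g h.
Proof. by rewrite /comm opprB. Qed.

Lemma comm1 h : comm 1%g h = 0.
Proof. by rewrite /comm mul1g mulg1 subrr. Qed.

Lemma commMl g g' h : comm (g * g')%g h = chi (K g') * comm g h + comm g' h.
Proof. by rewrite !commE upM KM chiD; exact: affine_commM. Qed.

Lemma commVl g h : comm g^-1%g h = - (chi (K g^-1%g) * comm g h).
Proof.
by apply/eqP; rewrite -addr_eq0 addrC -commMl mulgV comm1.
Qed.

(* The subgroup of the elements commuting with [h] modulo spaced torsion, which *)
(* is an ideal.                                                                *)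
Lemma torsion_comm_subgroup h : is_subgroup [set g | spaced_torsion (comm g h)].
Proof.
split=> [|x y tx ty] /=; first by rewrite comm1; exact: spaced_torsion0.
rewrite commMl commVl; apply: spaced_torsionD.
  exact: spaced_torsionM.
by apply: spaced_torsionN; exact: spaced_torsionM.
Qed.

Variable S : set G.
Hypothesis genS : generated S = [set: G].

Lemma exists_coords_delta : exists g, K g = 0 /\ up g = 1.
Proof.
have dm : delta_gen p \in generated ([set delta_gen p] `|` range (@M_gen d p)).
  by apply/mem_set => H [_]; apply; left.
exists (exist _ (delta_gen p) dm : G).
have := coords (exist _ (delta_gen p) dm : G).
by rewrite -[gmat _]/(ut 1 1 (chi 0)) => /ut_inj[_ <- /(chi_inj spaced) <-].
Qed.

Lemma exists_coords_M i : exists g, K g = delta_mx 0 i /\ up g = 0.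
Proof.
have mm : M_gen p i \in generated ([set delta_gen p] `|` range (@M_gen d p)).
  by apply/mem_set => H [_]; apply; right; exists i.
exists (exist _ (M_gen p i) mm : G).
have := coords (exist _ (M_gen p i) mm : G).
by rewrite -[gmat _]/(ut 1 0 (chi (delta_mx 0 i))) => /ut_inj[_ <- /(chi_inj spaced) <-].
Qed.

(** Otherwise [torsion_comm_subgroup], used in one argument and then in the other, makes all
    commutators torsion; that of [delta_gen] and [M_gen i] is x_i - 1. *)
Lemma exists_comm_not_torsion (i : 'I_d) :
  exists a b, [/\ S a, S b & ~ spaced_torsion (comm a b)].
Proof.
apply: contrapT => no.
have tor a b : S a -> S b -> spaced_torsion (comm a b).
  by move=> Sa Sb; apply: contrapT => ntor; apply: no; exists a, b.
have tor1 a b : S b -> spaced_torsion (comm a b).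
  move=> Sb; apply: (generated_elim genS (torsion_comm_subgroup b)) => // x Sx.
  exact: tor.
have tor2 a b : spaced_torsion (comm a b).
  apply: (generated_elim genS (torsion_comm_subgroup b)) => // x Sx /=.
  by rewrite commC; apply/spaced_torsionN/tor1.
have [g [Kg ug]] := exists_coords_delta; have [h [Kh uh]] := exists_coords_M i.
have i0 : delta_mx 0 i != 0 :> 'rV[int]_d.
  by apply/eqP => /matrixP/(_ 0 i); rewrite !mxE !eqxx.
apply: (spaced_not_torsion spaced i0).
by have := tor2 g h; rewrite commE Kh ug uh mul0r subr0 mul1r.
Qed.

End Coordinates.

End PolynomialGroup.

(** * Separation and independence *)

Section Residues.
Variables (d : nat) (N : nat).
Local Open Scope ring_scope.
Implicit Types k : 'rV[int]_d.

Definition residue k : 'rV['I_N.+1]_d := \row_i inord `|(k ord0 i %% N.+1%:Z)%Z|%N.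

Lemma residue_eq k k' : residue k = residue k' -> exists l, k = k' + l *+ N.+1.
Proof.
move=> /matrixP e; exists (\row_i ((k ord0 i - k' ord0 i)%R %/ N.+1%:Z)%Z).
apply/matrixP => i j; rewrite ord1 !mxE mulmxnE !mxE.
have lt (x : int) : (`|(x %% N.+1%:Z)%Z| < N.+1)%N.
  by have := @ltz_pmod x N.+1%:Z isT; have := @modz_ge0 x N.+1%:Z isT; lia.
have := e 0 j; rewrite !mxE => /(congr1 (fun i : 'I_N.+1 => i : nat)).
rewrite !inordK // => ekk'.
have {}ekk' : (k ord0 j = k' ord0 j %[mod N.+1%:Z])%Z.
  have := @modz_ge0 (k 0 j) N.+1%:Z isT; have := @modz_ge0 (k' 0 j) N.+1%:Z isT.
  by move: ekk'; lia.
have dv : (N.+1%:Z %| (k ord0 j - k' ord0 j)%R)%Z by rewrite -eqz_mod_dvd; apply/eqP.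
by rewrite -mulr_natr natz divzK // addrC subrK.
Qed.

End Residues.

Section Separation.
Variables (d : nat) (p : laurent d) (q : lquot p).
Local Open Scope ring_scope.
Local Notation chi := (@chi d p).

Lemma lproj_bool (b b' : bool) k :
  lproj p (lmono (b%:R - b'%:R) k) = chi k *+ b - chi k *+ b'.
Proof.
have lmonoN1 : lmono (-1) k = - lmono 1 k :> laurent d.
  by apply: (addrI (lmono 1 k)); rewrite -lmonoD !subrr lmono0.
case: b; case: b'; rewrite /= ?mulr1n ?mulr0n ?subrr ?subr0 ?sub0r ?lmono0 ?pr0 //.
by rewrite lmonoN1 prN.
Qed.

(** All points of [r] lie in one coset, so after division by the monomial of [k1] the difference of
    the two sums is u(x^N) q, where u has the coefficients c - c' and must therefore vanish. *)
Lemma separation_of_not_torsion : ~ spaced_torsion q ->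
  exists N, forall r : seq 'rV[int]_d, uniq r ->
    forall kappa, {in r, forall k, residue N k = kappa} ->
    forall c c' : 'rV[int]_d -> bool,
    \sum_(k <- r) (q * chi k) *+ c k = \sum_(k <- r) (q * chi k) *+ c' k -> {in r, c =1 c'}.
Proof.
move=> ntor; have [N [N0 hN]] : exists N, (0 < N)%N /\ forall u, u != 0 -> small_coeffs u ->
    lproj p (lsubst N u) * q <> 0.
  apply: contrapT => no; apply: ntor => N N0; apply: contrapT => no'; apply: no.
  by exists N; split=> // u u0 su uq; apply: no'; exists u.
(* The positive spacing is rewritten as a successor, since [residue N] reduces modulo [N.+1]. *)
case: N N0 hN => // N _ hN; exists N => r uniq_r kappa rk c c' eqs k1 k1r.
have [l Hl] : exists l : 'rV[int]_d -> 'rV[int]_d, {in r, forall k, k = k1 + l k *+ N.+1}.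
  have /choice[l Hl] : forall k, exists lk, k \in r -> k = k1 + lk *+ N.+1.
    move=> k; have [kr|nkr] := boolP (k \in r); last by exists 0.
    by have [|lk e] := @residue_eq d N k k1; [rewrite !rk|exists lk].
  by exists l.
have l_inj k k' : k \in r -> k' \in r -> l k = l k' -> k = k'.
  by move=> kr k'r e; rewrite (Hl k kr) (Hl k' k'r) e.
pose e k : int := (c k)%:R - (c' k)%:R.
pose u : laurent d := \sum_(k <- r) lmono (e k) (l k).
have coeffu m : monalg.mcoeff m u = \sum_(k <- r) if l k == m then e k else 0.
  by rewrite lcoeff_sum; apply: eq_bigr => k _; rewrite mcoeff_lmono.
have coeffl k : k \in r -> monalg.mcoeff (l k) u = e k.
  move=> kr; rewrite coeffu (bigD1_seq k) //= eqxx big_seq_cond big1 ?addr0 // => k' /andP[k'r k'k].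
  by case: eqP => // /(l_inj _ _ k'r kr) E; rewrite E eqxx in k'k.
have su : small_coeffs u.
  move=> m; have [[k [kr <-]]|no] := pselect (exists k, k \in r /\ l k = m).
    by rewrite coeffl // /e; case: (c k); case: (c' k).
  rewrite coeffu big_seq big1 // => k kr; case: eqP => // lkm.
  by case: no; exists k.
suff : u = 0.
  move=> u0; have := coeffl k1 k1r; rewrite u0 lcoeff0 /e.
  by case: (c k1); case: (c' k1).
apply/eqP/negPn/negP => u0; apply: (hN u u0 su).
have chiE k : k \in r -> lproj p (lmono (e k) (l k *+ N.+1)) * q =
    chi (- k1) * ((q * chi k) *+ c k - (q * chi k) *+ c' k).
  have kE : k \in r -> chi k = chi k1 * chi (l k *+ N.+1) by rewrite -chiD => /Hl <-.
  move=> kr; rewrite lproj_bool kE //.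
  have := chiNK p k1; move: (chi (- k1)) (chi k1) (chi (l k *+ N.+1)) => x y z xy.
  have xyz : x * (q * (y * z)) = z * q.
    by rewrite (mulrA x) (mulrC x q) -mulrA (mulrA x) xy mul1r mulrC.
  by rewrite mulrBr !mulrnAr xyz mulrBl !mulrnAl.
have -> : lsubst N.+1 u = \sum_(k <- r) lmono (e k) (l k *+ N.+1).
  rewrite (big_morph (lsubst N.+1) (@lsubstD _ _) (@lsubst0 _ _)).
  by apply: eq_bigr => k _; rewrite lsubst_lmono.
rewrite (big_morph (lproj p) (@prD _ p) (@pr0 _ p)) mulr_suml.
by rewrite (eq_big_seq _ chiE) -mulr_sumr sumrB eqs subrr mulr0.
Qed.

End Separation.

(** * Linear independence of three steps *)

Section Independence.
Local Open Scope ring_scope.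
Implicit Types u v w : 'rV[int]_3.

Definition det3 u v w : int :=
  u 0 0 * (v 0 1 * w 0 (2 : 'I_3) - v 0 (2 : 'I_3) * w 0 1)
  - u 0 1 * (v 0 0 * w 0 (2 : 'I_3) - v 0 (2 : 'I_3) * w 0 0)
  + u 0 (2 : 'I_3) * (v 0 0 * w 0 1 - v 0 1 * w 0 0).

Lemma det3D u u' v w : det3 (u + u') v w = det3 u v w + det3 u' v w.
Proof. by rewrite /det3 !mxE; ring. Qed.

Lemma det3N u v w : det3 (- u) v w = - det3 u v w.
Proof. by rewrite /det3 !mxE; ring. Qed.

Lemma det3_rot u v w : det3 v w u = det3 u v w.
Proof. by rewrite /det3; ring. Qed.

Lemma det3_l v w : det3 v v w = 0.
Proof. by rewrite /det3; ring. Qed.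

Lemma det3_r v w : det3 w v w = 0.
Proof. by rewrite /det3; ring. Qed.

Lemma det3_0 v w : det3 0 v w = 0.
Proof. by rewrite /det3 !mxE; ring. Qed.

Lemma det3Mn u v w n : det3 (u *+ n) v w = det3 u v w *+ n.
Proof. by elim: n => [|n IH]; rewrite ?mulr0n ?det3_0 // !mulrSr det3D IH. Qed.

Lemma det3_delta : det3 (delta_mx 0 0) (delta_mx 0 1) (delta_mx 0 2) = 1.
Proof. by rewrite /det3 !mxE. Qed.

(** Cramer's rule: putting the combination in place of one vector multiplies the determinant by the
    coefficient of that vector. *)
Lemma det3_free u v w : det3 u v w != 0 ->
  injective (fun n : nat * nat * nat => u *+ n.1.1 + v *+ n.1.2 + w *+ n.2).
Proof.
have coord x y z (m : nat * nat * nat) :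
    det3 (x *+ m.1.1 + y *+ m.1.2 + z *+ m.2) y z = det3 x y z *+ m.1.1.
  by rewrite !det3D !det3Mn det3_l det3_r !mul0rn !addr0.
move=> D0 [[i j] k] [[i' j'] k'] /= e.
have inj : injective (fun n => det3 u v w *+ n) := mulrIn D0.
have := congr1 (fun x => det3 x v w) e.
rewrite (coord u v w (i, j, k)) (coord u v w (i', j', k')) /= => /inj ii'.
have e2 : v *+ j + w *+ k + u *+ i = v *+ j' + w *+ k' + u *+ i'.
  by rewrite addrC addrA e -addrA addrC.
have := congr1 (fun x => det3 x w u) e2.
rewrite (coord v w u (j, k, i)) (coord v w u (j', k', i')) /= (det3_rot u v w) => /inj jj'.
have e3 : w *+ k + u *+ i + v *+ j = w *+ k' + u *+ i' + v *+ j'.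
  by rewrite addrC addrA e2 -addrA addrC.
have := congr1 (fun x => det3 x u v) e3.
rewrite (coord w u v (k, i, j)) (coord w u v (k', i', j')) /= (det3_rot v w u) (det3_rot u v w) => /inj kk'.
by rewrite ii' jj' kk'.
Qed.

End Independence.

Section IndependentSteps.
Variables (G : groupType) (K : G -> 'rV[int]_3) (S : set G).
Local Open Scope ring_scope.
Local Open Scope classical_set_scope.
Hypothesis KM : forall g h, K (g * h)%g = K g + K h.
Hypothesis genS : generated S = [set: G].
Hypothesis K_unit : forall i, exists g, K g = delta_mx 0 i.

Lemma det3_subgroup v w : is_subgroup [set g | det3 (K g) v w = 0].
Proof.
have K1 : K 1%g = 0 by apply: (addIr (K 1%g)); rewrite -KM mul1g add0r.
split=> [|x y /= Dx Dy]; first by rewrite /= K1 det3_0.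
have -> : K (x / y)%g = K x + - K y.
  by apply: (addIr (K y)); rewrite -KM divgK addrNK.
by rewrite det3D det3N Dx Dy subr0.
Qed.

(** The determinant is additive in each argument, so vanishing on the support would spread to the
    whole group one argument at a time, against the unit vectors. *)
Lemma exists_independent_steps : exists a b c,
  [/\ S a, S b, S c & det3 (K a) (K b) (K c) != 0].
Proof.
apply: contrapT => no.
have elim v w g : (forall x, S x -> det3 (K x) v w = 0) -> det3 (K g) v w = 0.
  by move=> H; exact: (generated_elim genS (det3_subgroup v w) H).
have D1 g b c : S b -> S c -> det3 (K g) (K b) (K c) = 0.
  move=> Sb Sc; apply: elim => a Sa; apply/eqP/negPn/negP => D0.
  by apply: no; exists a, b, c.
have D2 g h c : S c -> det3 (K g) (K h) (K c) = 0.
  by move=> Sc; rewrite -det3_rot; apply: elim => b Sb; rewrite det3_rot; exact: D1.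
have D3 g h k : det3 (K g) (K h) (K k) = 0.
  by rewrite det3_rot; apply: elim => c Sc; rewrite -det3_rot; exact: D2.
have [g0 e0] := K_unit 0; have [g1 e1] := K_unit 1; have [g2 e2] := K_unit 2.
by have := D3 g0 g1 g2; rewrite e0 e1 e2 det3_delta.
Qed.

End IndependentSteps.

Theorem theoremB (R : realType) (p : mpoly 3 int) :
  spaced_polynomial_property (laurent_of_mpoly p) ->
  forall mu : Gpoly (laurent_of_mpoly p) -> R,
    is_probability mu -> finite_entropy mu -> irreducible mu ->
    poisson_boundary_nontrivial mu.
Proof.
move=> spaced mu mu_prob mu_ent mu_irr.
have [K [up coords]] := gmat_coords (laurent_of_mpoly p).
have KM := KM spaced coords; have upM := upM spaced coords.
have mu_gt0 g : supp mu g -> (0 < mu g)%R.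
  by move=> mg; rewrite lt_neqAle eq_sym mg (mu_prob.1 g).
have K_unit i : exists g, K g = delta_mx 0%R i.
  by have [g [Kg _]] := exists_coords_M spaced coords i; exists g.
have [a1 [a2 [a3 [Sa1 Sa2 Sa3 D0]]]] := exists_independent_steps KM mu_irr K_unit.
have [a [b [Sa Sb ntor]]] := exists_comm_not_torsion spaced coords mu_irr ord0.
have [N sep] := separation_of_not_torsion ntor.
have [F [F01 hF [g Fg]]] := exists_bounded_harmonic mu_prob mu_ent KM upM
  (mu_gt0 _ Sa) (mu_gt0 _ Sb) (mu_gt0 _ Sa1) (mu_gt0 _ Sa2) (mu_gt0 _ Sa3) (det3_free D0) sep.
(* By irreducibility the subgroup generated by the support is the whole group. *)
exists F; rewrite mu_irr; split=> [|h _|]; first 2 last.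
- by exists g, 1%g.
- exists 1%R => h _; rewrite ger0_norm; by case/andP: (F01 h).
- exact: hF.
Qed.
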